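(* For a general $M\times K$ F-RAN (serial fronthaul-edge transmission), $$\frac{\delta_{\mathsf{Ach}}(\mu,r)}{\delta^*(\mu,r)}\le 2$$ for $\mu\in[1/M,1]$ when $r=0$ (cache-only F-RAN), and for $\mu\in[0,1]$ when $r>0$ (cloud and cache-aided F-RAN). Here $\delta^*(\mu,r)$ is the minimum NDT and, with $r_{\mathsf{th}}=\frac{K(M-1)}{M(\min\{M,K\}-1)}$, the achievable NDT $\delta_{\mathsf{Ach}}(\mu,r)$ is defined by $$\delta_{\mathsf{Ach}}(\mu,r)=\begin{cases}(M+K-1)\mu+(1-\mu M)\left[\frac{K}{\min\{M,K\}}+\frac{K}{Mr}\right], & \mu\le 1/M,\ r\le r_{\mathsf{th}},\\[4pt] \frac{K}{\min\{M,K\}}\cdot\frac{\mu M-1}{M-1}+(1-\mu)\frac{M+K-1}{M-1}, & \mu\ge1/M,\ r\le r_{\mathsf{th}},\\[4pt] \frac{K}{\min\{M,K\}}+\frac{(1-\mu)K}{Mr}, & \mu\in[0,1],\ r\ge r_{\mathsf{th}}.\end{cases}$$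
   Context: F-RAN model (serial transmission). $M$ edge nodes (ENs) serve $K$ users from a library of $N\ge K$ files $F_1,\dots,F_N$, independent and uniform on $\{1,\dots,2^L\}$. The channel $\mathbf H=(h_{km})\in\mathbb C^{K\times M}$ has entries drawn i.i.d. from a continuous distribution, is constant during a transmission interval and known to all nodes. The demand vector $\mathbf D=(d_1,\dots,d_K)\in\{1,\dots,N\}^K$ is known to the cloud and ENs. With power $P$ and fronthaul rate $r\ge0$, put $C_F=r\log P$. A policy for file size $L$ consists of: (a) caching functions $S_{m,n}=\pi^m_{c,n}(F_n)$ with entropy $H(S_{m,n})\le\mu L$ (not depending on $\mathbf D,\mathbf H$; $\mu\in[0,1]$ is the fractional cache size), with $S_m=(S_{m,1},\dots,S_{m,N})$; (b) fronthaul messages $\mathbf U_m^{T_F}=\pi_f^m(F_1,\dots,F_N,S_m,\mathbf D,\mathbf H)$ of at most $T_FC_F$ bits; (c) edge codewords $\mathbf X_m^{T_E}=\pi_e^m(S_m,\mathbf U_m^{T_F},\mathbf D,\mathbf H)\in\mathbb C^{T_E}$ with average power at most $P$; (d) decoders $\widehat F_{d_k}=\pi_d^k(\mathbf Y_k^{T_E},d_k,\mathbf H)$, where $\mathbf Y_k^{T_E}=\sum_{m=1}^M h_{km}\mathbf X_m^{T_E}+\mathbf n_k^{T_E}$ and the noise entries are i.i.d. $\mathcal{CN}(0,1)$ over time and users. The error probability is $P_e=\max_{\mathbf D}\max_k\mathbb P(\widehat F_{d_k}\ne F_{d_k})$. A sequence of policies indexed by $L$ is feasible if, for almost all $\mathbf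 H$, $P_e\to0$ as $L\to\infty$. A delivery time per bit $\Delta(\mu,C_F,P)$ is achievable if some sequence of feasible policies has $\Delta(\mu,C_F,P)=\limsup_{L\to\infty}(T_F+T_E)/L$. The corresponding (achievable) normalized delivery time (NDT) is $\delta(\mu,r)=\lim_{P\to\infty}\Delta(\mu,r\log P,P)\,\log P$. The minimum NDT $\delta^*(\mu,r)$ is the infimum of all achievable $\delta(\mu,r)$. *)

(* Defs.v *)
From HB Require Import structures.
From mathcomp Require Import all_boot all_order all_algebra.
From mathcomp Require Import all_classical all_reals all_analysis.
From mathcomp Require Import complex.

Set Implicit Arguments.
Unset Strict Implicit.
Unset Printing Implicit Defensive.

Import Order.TTheory GRing.Theory Num.Theory.
Import numFieldNormedType.Exports.

Local Open Scope classical_set_scope.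
Local Open Scope ring_scope.

(* All information quantities are in bits. *)
Definition log2 (R : realType) (x : R) : R := ln x / ln 2.

(* As [ln 0 = 0], atoms of mass zero contribute nothing. *)
Definition entropy (R : realType) (T : finType) (p : T -> R) : R :=
  - \sum_(t : T) p t * log2 (p t).

Definition image_pmf (R : realType) (A T : finType) (g : A -> T) (t : T) : R :=
  #|[pred a | g a == t]|%:R / #|A|%:R.

(* [R[i]] carries no measurable structure: its Borel sets are handled through
   the identification with R * R by real and imaginary parts. *)
Definition reim (R : realType) (z : R[i]) : R * R :=
  (complex.Re z, complex.Im z).

(* The Borel sigma-algebra of C^T, generated by the T complex coordinates. *)
Definition borel_rV (R : realType) (T : nat) : set (set 'rV[R[i]]_T) :=
  g_sigma_preimage (fun t (y : 'rV[R[i]]_T) => reim (y 0 t)).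

Definition iid (R : realType) (d : measure_display) (Omega : measurableType d)
    (Pr : probability Omega R) (I : eqType) (X : I -> Omega -> R[i])
    (law : set (R * R) -> \bar R) : Prop :=
  (forall i, measurable_fun [set: Omega] (fun w => reim (X i w))) /\
  (forall (s : seq I) (B : I -> set (R * R)), uniq s ->
     (forall i, measurable (B i)) ->
     Pr [set w | forall i, i \in s -> B i (reim (X i w))] =
     (\prod_(i <- s) law (B i))%E).

Definition continuous_law (R : realType) (law : set (R * R) -> \bar R) : Prop :=
  forall z : R * R, law [set z] = 0%E.

(* CN(0,1): independent real and imaginary parts, each of variance 1/2
   (the second parameter of [normal_prob] is the standard deviation). *)
Definition CN01 (R : realType) : set (R * R) -> \bar R :=
  (normal_prob (0 : R) (Num.sqrt (2^-1)) \x
   normal_prob (0 : R) (Num.sqrt (2^-1)))%E.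

Section FRAN.
Variables (R : realType) (K M N : nat).

(* A file is an element of a set of 2 ^ L elements. *)
Definition library (L : nat) := {ffun 'I_N -> 'I_(2 ^ L)}.
Definition demand := {ffun 'I_K -> 'I_N}.
Definition channel := 'M[R[i]]_(K, M).

Record policy (mu CF P : R) (L : nat) := Policy {
  TF : nat;
  TE : nat;
  cacheT : 'I_M -> 'I_N -> finType;
  cache : forall m n, 'I_(2 ^ L) -> cacheT m n;
  frontT : 'I_M -> finType;
  front : forall m, library L -> (forall n, cacheT m n) ->
    demand -> channel -> frontT m;
  edge : forall m, (forall n, cacheT m n) -> frontT m ->
    demand -> channel -> 'rV[R[i]]_TE;
  decoder : 'I_K -> 'rV[R[i]]_TE -> 'I_N -> channel -> 'I_(2 ^ L);
  cache_size : forall m n, entropy (image_pmf R (@cache m n)) <= mu * L%:R;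
  front_size : forall m, #|frontT m|%:R <= 2 `^ (TF%:R * CF);
  edge_power : forall m (f : library L) (D : demand) (H : channel),
    let S n := cache m n (f n) in
    let X := edge S (front f S D H) D H in
    \sum_(t < TE) (complex.Re (X 0 t) ^+ 2 + complex.Im (X 0 t) ^+ 2)
      <= TE%:R * P;
  decoder_measurable : forall k n (H : channel) (j : 'I_(2 ^ L)),
    borel_rV [set y | decoder k y n H = j]
}.

Section performance.
Variables (mu CF P : R) (L : nat) (p : policy mu CF P L).

Definition cached (f : library L) (m : 'I_M) (n : 'I_N) : cacheT p m n :=
  cache p m n (f n).

Definition codeword (f : library L) (D : demand) (H : channel) (m : 'I_M) :
    'rV[R[i]]_(TE p) :=
  edge (@cached f m) (front f (@cached f m) D H) D H.

Definition received (f : library L) (D : demand) (H : channel)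
    (z : nat -> R[i]) (k : 'I_K) : 'rV[R[i]]_(TE p) :=
  \row_(t < TE p) (\sum_(m < M) H k m * codeword f D H m 0 t + z t).

Variables (dZ : measure_display) (OmegaZ : measurableType dZ)
  (PZ : probability OmegaZ R) (Z : 'I_K * nat -> OmegaZ -> R[i]).

(* Given the channel realization H, the probability is over the independent
   uniform files, i.e. a uniform element of [library L], and over the
   noise. *)
Definition user_error (H : channel) (D : demand) (k : 'I_K) : \bar R :=
  ((#|{: library L}|%:R^-1)%:E * \sum_(f : library L)
    PZ [set w | decoder k (received f D H (fun t => Z (k, t) w) k) (D k) H
                <> f (D k)])%E.

Definition error_prob (H : channel) : \bar R :=
  \big[maxe/0%E]_(D : demand) \big[maxe/0%E]_(k < K) user_error H D k.

End performance.

Section ndt.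
Variables (dH dZ : measure_display)
  (OmegaH : measurableType dH) (PH : probability OmegaH R)
  (H : OmegaH -> channel)
  (OmegaZ : measurableType dZ) (PZ : probability OmegaZ R)
  (Z : 'I_K * nat -> OmegaZ -> R[i]).

Definition feasible (mu CF P : R) (p : forall L, policy mu CF P L) : Prop :=
  {ae PH, forall w, error_prob (p L) PZ Z (H w) @[L --> \oo] --> 0%E}.

Definition achievable_time (mu CF P Delta : R) : Prop :=
  exists p : forall L, policy mu CF P L, feasible p /\
    limn_esup (fun L => (((TF (p L) + TE (p L))%:R : R) / L%:R)%:E) = Delta%:E.

Definition achievable_ndt (mu r delta : R) : Prop :=
  exists Delta : R -> R,
    (\forall P \near +oo, achievable_time mu (r * log2 P) P (Delta P)) /\
    Delta P * log2 P @[P --> +oo] --> delta.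

Definition min_ndt (mu r : R) : \bar R :=
  ereal_inf [set delta%:E | delta in achievable_ndt mu r].

End ndt.
End FRAN.

(* Extended-real division: [r_th] is +oo when K = 1 < M. When M = 1 the quotient
   0 / 0 is 0, and this choice is immaterial because the first and third cases
   of [ndt_ach] are then the same expression. *)
Definition r_th (R : realType) (K M : nat) : \bar R :=
  ((K%:R * (M%:R - 1))%:E / (M%:R * ((minn M K)%:R - 1))%:E)%E.

(* The cases agree wherever they overlap. For r = 0 only mu >= 1/M is
   meaningful; at mu = 1/M the term in K / (M r) carries the factor 0. *)
Definition ndt_ach (R : realType) (K M : nat) (mu r : R) : R :=
  let k : R := K%:R in
  let m : R := M%:R in
  let n : R := (minn M K)%:R in
  if (r%:E <= r_th R K M)%E then
    if mu <= m^-1 then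
      (m + k - 1) * mu + (1 - mu * m) * (k / n + k / (m * r))
    else
      k / n * ((mu * m - 1) / (m - 1)) + (1 - mu) * ((m + k - 1) / (m - 1))
  else k / n + (1 - mu) * k / (m * r).

(* Main.v *)
(** Only the converse bounds are needed: with n = min(M, K), every achievable NDT
    delta satisfies delta >= K / n and, for r > 0,
    delta >= K / n + K (1 - mu M) / (M r); comparing these two bounds with the
    three branches of the achievable NDT is elementary.

    Both bounds come from one counting inequality. If the K demanded files are
    decoded from a statistic v and independent noise, then for every weight w
    the success probabilities p_f satisfy sum_f p_f w(v f) <= sum_v w(v), and
    Gibbs' inequality turns this into a bound on the number of files.
    - Fronthaul: v consists of the caches and the fronthaul messages, and w is
      the product of the marginal distributions of the cache contents, so that
      -log w averages to the sum of the cache entropies.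
    - Edge: v is the codeword rounded to the integer lattice. Rounding shifts the
      received signal by a bounded amount, and a boundedly shifted Gaussian is
      dominated, up to a constant factor per symbol, by one fixed Gaussian,
      whatever the shift. Polynomial weights 1 / (1 + |a| / sqrt P)^2 then show
      that the rounded codewords count for n T_E log P + O(T_E). Rounding the
      M transmitted signals or the K noiseless received signals, whichever are
      fewer, produces n, without any assumption on the rank of H. *)

Require Import Defs.
From HB Require Import structures.
From mathcomp Require Import all_boot all_order all_algebra.
From mathcomp Require Import all_classical all_reals all_analysis.
From mathcomp Require Import complex measurable_realfun ring lra.

Set Implicit Arguments.
Unset Strict Implicit.
Unset Printing Implicit Defensive.

Import Order.TTheory GRing.Theory Num.Theory.
Import numFieldNormedType.Exports.

Local Open Scope classical_set_scope.
Local Open Scope ring_scope.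

(** * Gibbs' inequality and the counting of decodable files *)

Lemma ln_le_subr1 (R : realType) (x : R) : 0 < x -> ln x <= x - 1.
Proof.
move=> x0; have := @le_ln1Dx R (x - 1).
by rewrite [1 + _]addrC subrK; apply; rewrite ltrBrDl subrr.
Qed.

(* Gibbs' inequality, from [ln x <= x - 1] at [x = w f * S / W]. *)
Lemma weighted_gibbs (R : realType) (F : finType) (p w : F -> R) (W : R) :
    (forall f, 0 <= p f <= 1) -> (forall f, 0 < w f <= 1) ->
    \sum_f p f * w f <= W -> 0 < \sum_f p f ->
  (\sum_f p f) * ln (\sum_f p f) + \sum_f ln (w f) <= (\sum_f p f) * ln W.
Proof.
set S := \sum_f p f => p01 w01 pwW S0.
have pw_ge0 f : true -> 0 <= p f * w f.
  by case/andP: (p01 f) (w01 f) => p0 _ /andP[/ltW w0 _] _; exact: mulr_ge0.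
have W0 : 0 < W.
  apply: lt_le_trans pwW; rewrite lt_neqAle eq_sym sumr_ge0 ?andbT//.
  apply/negP => /eqP pw0; move: S0; rewrite /S big1 ?ltxx// => f _.
  have /eqP : p f * w f = 0.
    exact: (psumr_eq0P _ pw0).
  rewrite mulf_eq0 => /orP[/eqP//|/eqP wf0].
  by case/andP: (w01 f); rewrite wf0 ltxx.
have key f : p f * (ln S - ln W) + ln (w f) <= p f * w f * (S / W) - p f.
  have [/andP[p0 p1] /andP[w0 w1]] := (p01 f, w01 f).
  apply: (@le_trans _ _ (p f * ln (w f * (S / W)))).
    rewrite lnM ?posrE ?divr_gt0// lnM ?lnV ?posrE ?invr_gt0//.
    (* As [p f] and [w f] are at most 1, [ln (w f) <= p f * ln (w f)]; hence [ln (w f)] enters the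
       conclusion with coefficient one. *)
    have : (p f - 1) * ln (w f) >= 0 by rewrite mulr_le0 ?subr_le0// ln_le0.
    lra.
  rewrite -mulrA -{3}[p f]mulr1 -mulrBr ler_wpM2l// ln_le_subr1//.
  by rewrite mulr_gt0// divr_gt0.
have : \sum_f (p f * (ln S - ln W) + ln (w f)) <= 
       \sum_f (p f * w f * (S / W) - p f) by apply: ler_sum.
rewrite !big_split/= sumrN -!mulr_suml -/S => h.
have : (\sum_f p f * w f) * (S / W) <= S.
  rewrite mulrA ler_pdivrMr// mulrC ler_wpM2l// ltW//.
by move: h; rewrite mulrBr; lra.
Qed.

Lemma sum_disjoint_le1 d (T : measurableType d) (R : realType)
    (P : probability T R) (F : finType) (A : {pred F}) (E : F -> set T) :
    (forall f, measurable (E f)) ->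
    (forall f g, f \in A -> g \in A -> f != g -> E f `&` E g = set0) ->
  \sum_(f in A) fine (P (E f)) <= 1.
Proof.
move=> mE dE; rewrite -lee_fin -sumEFin.
under eq_bigr do rewrite fineK ?fin_num_measure//.
rewrite -big_filter.
suff {}H : forall s : seq F, uniq s -> {subset s <= A} ->
    (P (\big[setU/set0]_(f <- s) E f) = \sum_(f <- s) P (E f))%E.
  rewrite -H ?filter_uniq ?index_enum_uniq//; first last.
    by move=> x; rewrite mem_filter => /andP[].
  by apply: probability_le1; apply: bigsetU_measurable.
elim=> [|f s IH]; first by rewrite !big_nil measure0.
rewrite /= => /andP[fs us] sA; rewrite !big_cons measureU//.
- by congr (_ + _)%E; apply: IH => // x xs; apply: sA; rewrite inE xs orbT.
- exact: bigsetU_measurable.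
- rewrite big_distrr/= big1_seq// => g /andP[_ gs]; apply: dE.
  + by apply: sA; rewrite inE eqxx.
  + by apply: sA; rewrite inE gs orbT.
  + by apply: contraNneq fs => ->.
Qed.

(** Group the [f] by the value of [v]: on one fibre the events are disjoint, so the fibre over [x]
    contributes at most [w x]. *)
Lemma sum_weighted_success_le d (T : measurableType d) (R : realType)
    (P : probability T R) (F V : finType) (v : F -> V) (w : V -> R)
    (E : F -> set T) :
    (forall f, measurable (E f)) -> (forall x, 0 <= w x) ->
    (forall f g, v f = v g -> f != g -> E f `&` E g = set0) ->
  \sum_f fine (P (E f)) * w (v f) <= \sum_x w x.
Proof.
move=> mE w0 dE; rewrite (partition_big v predT)//=; apply: ler_sum => x _.
rewrite (eq_bigr (fun f => fine (P (E f)) * w x)); last by move=> f /eqP ->.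
rewrite -mulr_suml ler_piMl//.
apply: (@sum_disjoint_le1 _ _ _ P F [pred f | v f == x] E) => // f g.
by rewrite !inE => /eqP vf /eqP vg; apply: dE; rewrite vf vg.
Qed.

Lemma card_off_codom (K N : nat) (D : 'I_K -> 'I_N) : injective D ->
  #|{: {n | n \notin codom D}}| = (N - K)%N.
Proof.
move=> injD; rewrite card_sig; set c := #|_|.
suff H : (K + c)%N = N by rewrite -[in RHS]H addKn.
rewrite -[RHS]card_ord -(cardC (mem (codom D))) card_codom// card_ord.
by congr (_ + _)%N; apply: eq_card => n; rewrite !inE.
Qed.

(* The undemanded files are revealed to the decoders: they contribute the
   factor [#|T| ^ (N - K)], so that only [K] files remain on the left. *)
Lemma decoding_bound d (Omega : measurableType d) (R : realType)
    (P : probability Omega R) (N K : nat) (T V : finType)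
    (D : 'I_K -> 'I_N) (v : {ffun 'I_N -> T} -> V) (w : V -> R)
    (E : {ffun 'I_N -> T} -> set Omega) (c : R) (e : R) :
    injective D -> (0 < #|T|)%N -> 0 <= c -> e < 1 ->
    (forall f, measurable (E f)) -> (forall x, 0 <= w x) ->
    (forall f, 0 < w (v f) <= 1) ->
    (forall f g, v f = v g -> f != g ->
      (forall n, n \notin codom D -> f n = g n) -> E f `&` E g = set0) ->
    forall p : {ffun 'I_N -> T} -> R,
    (forall f, 0 <= p f <= 1) -> (forall f, p f <= c * fine (P (E f))) ->
    (1 - e) * #|{: {ffun 'I_N -> T}}|%:R <= \sum_f p f ->
  K%:R * ln (#|T|%:R : R) <= ln c + ln (\sum_x w x) - ln (1 - e)
    - (#|{: {ffun 'I_N -> T}}|%:R^-1 * \sum_f ln (w (v f))) / (1 - e).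
Proof.
move=> injD T0 c0 e1 mE wx w01 dE p p01 pE sp.
have KN : (K <= N)%N by have := leq_card D injD; rewrite !card_ord.
(* The undemanded files join the statistic without changing its weight, so that equality of [v']
   supplies the agreement off [codom D] needed for disjointness. *)
pose O := {ffun {n | n \notin codom D} -> T}.
pose v' f : V * O := (v f, [ffun n => f (sval n)]).
pose w' (x : V * O) := w x.1.
have cardF : (#|{: {ffun 'I_N -> T}}|%:R : R) = #|T|%:R ^+ N.
  by rewrite card_ffun card_ord natrX.
have cF0 : 0 < (#|{: {ffun 'I_N -> T}}|%:R : R).
  by rewrite cardF exprn_gt0// ltr0n.
have e1' : 0 < 1 - e by rewrite subr_gt0.
have S0 : 0 < \sum_f p f by apply: lt_le_trans sp; rewrite mulr_gt0.
have sumw' : \sum_x w' x = #|T|%:R ^+ (N - K) * \sum_x w x.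
  rewrite -(pair_bigA _ (fun x o => w' (x, o)))/= /w'/=.
  under eq_bigr do rewrite sumr_const.
  rewrite card_ffun card_off_codom// mulr_sumr.
  by apply: eq_bigr => x _; rewrite -natrX -[RHS]mulrC mulr_natr.
have pw : \sum_f p f * w (v f) <= c * (#|T|%:R ^+ (N - K) * \sum_x w x).
  rewrite -sumw'.
  have := @sum_weighted_success_le _ _ _ P _ _ v' w' E mE.
  have w'0 x : 0 <= w' x by exact: wx.
  move=> /(_ w'0) H; apply: le_trans (ler_wpM2l c0 (H _)); last first.
    move=> f g [vfg /ffunP fg] neq; apply: dE => // n nD.
    by have := fg (exist _ n nD); rewrite !ffunE.
  rewrite mulr_sumr; apply: ler_sum => f _; rewrite mulrA ler_wpM2r//.
have c0' : 0 < c.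
  rewrite lt_neqAle c0 andbT; apply/negP => /eqP c00; move: S0.
  rewrite big1 ?ltxx// => f _; apply/eqP; rewrite eq_le.
  by case/andP: (p01 f) => -> _; rewrite andbT (le_trans (pE f))// -c00 mul0r.
have w0 : 0 < \sum_x w x.
  have [f|F0] := pickP (fun f : {ffun 'I_N -> T} => true); last first.
    by move: S0; rewrite big1 ?ltxx// => f; have := F0 f.
  move=> _; rewrite (bigD1 (v f))//= ltr_pwDl//; first by case/andP: (w01 f).
  by apply: sumr_ge0 => x _; exact: wx.
have T0' : 0 < (#|T|%:R : R) by rewrite ltr0n.
have := weighted_gibbs p01 w01 pw S0.
rewrite lnM ?lnM ?posrE ?mulr_gt0 ?exprn_gt0// lnXn//.
set S := \sum_f p f in S0 sp *.
set LW := \sum_f ln (w (v f)).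
have LW0 : LW <= 0 by apply: sumr_le0 => f _; rewrite ln_le0//; case/andP: (w01 f).
move=> H.
have {}H : ln S + LW / S <= ln c + (ln (#|T|%:R) *+ (N - K) + ln (\sum_x w x)).
  rewrite -(ler_pM2l S0) mulrDr; congr (_ + _ <= _): H.
  by rewrite mulrCA divff ?mulr1// gt_eqF.
have lS : ln (1 - e) + ln (#|T|%:R) *+ N <= ln S.
  rewrite -lnXn// -lnM ?posrE ?exprn_gt0// ler_ln ?posrE ?mulr_gt0 ?exprn_gt0//.
  by rewrite -cardF.
(* [LW] is nonpositive, so replacing [S] by its lower bound only decreases the quotient. *)
have lw : (#|{: {ffun 'I_N -> T}}|%:R^-1 * LW) / (1 - e) <= LW / S.
  rewrite mulrC mulrA -invfM [leRHS]mulrC -subr_ge0 -mulrBl mulr_le0// subr_le0.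
  by rewrite lef_pV2 ?posrE// mulr_gt0.
have : ln (#|T|%:R) *+ N = ln (#|T|%:R) *+ (N - K) + K%:R * ln (#|T|%:R : R).
  by rewrite mulr_natl -mulrnDr subnK.
lra.
Qed.

(** Write the summand as a product over coordinates and distribute: every coordinate but [n] yields
    [#|T|]. The factor on the left avoids the exponent [N - 1]. *)
Lemma sum_ffun_coord (R : comPzRingType) (N : nat) (T : finType)
    (phi : T -> R) (n : 'I_N) :
  #|T|%:R * \sum_(f : {ffun 'I_N -> T}) phi (f n) =
  #|T|%:R ^+ N * \sum_x phi x.
Proof.
rewrite (eq_bigr (fun f : {ffun 'I_N -> T} =>
    \prod_i (if i == n then phi (f i) else 1))); last first.
  by move=> f _; rewrite -big_mkcond/= big_pred1_eq.
rewrite -(bigA_distr_bigA (fun i x => if i == n then phi x else 1)).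
rewrite (bigD1 n)//= eqxx mulrCA mulrC; congr (_ * _).
rewrite (eq_bigr (fun=> #|T|%:R)); last first.
  by move=> i /negbTE ->; rewrite sumr_const.
rewrite prodr_const -exprS; congr (_ ^+ _).
by rewrite cardC1 card_ord prednK// (leq_ltn_trans _ (ltn_ord n)).
Qed.

(** * Measures on function spaces *)

Lemma preimage_xsection (T1 T2 U1 U2 : Type) (f : T1 -> U1) (g : T2 -> U2)
    (B : set (U1 * U2)) (x : T1) :
  xsection ((fun z => (f z.1, g z.2)) @^-1` B) x = g @^-1` xsection B (f x).
Proof. by apply/seteqP; split => y; rewrite /xsection/= !inE. Qed.

Lemma measurable_pair_map d1 d2 d1' d2' (T1 : measurableType d1)
    (T2 : measurableType d2) (U1 : measurableType d1') (U2 : measurableType d2')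
    (f : T1 -> U1) (g : T2 -> U2) :
    measurable_fun [set: T1] f -> measurable_fun [set: T2] g ->
  measurable_fun [set: T1 * T2] (fun z => (f z.1, g z.2)).
Proof.
move=> mf mg; apply/measurable_fun_pairP; split.
- exact: measurableT_comp mf measurable_fst.
- exact: measurableT_comp mg measurable_snd.
Qed.

(** Bound the [m2]-measure of each section, then move the outer integral to the pushforward of [m1]
    by [f], which [c1] times [n1] dominates. *)
Lemma product_measure_le d1 d2 d1' d2' (T1 : measurableType d1)
    (T2 : measurableType d2) (U1 : measurableType d1') (U2 : measurableType d2')
    (R : realType) (m1 : probability T1 R) (m2 : probability T2 R)
    (n1 : probability U1 R) (n2 : probability U2 R) (c1 c2 : R)
    (f : T1 -> U1) (g : T2 -> U2) :
    0 <= c1 -> 0 <= c2 ->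
    measurable_fun [set: T1] f -> measurable_fun [set: T2] g ->
    (forall B, measurable B -> m1 (f @^-1` B) <= c1%:E * n1 B)%E ->
    (forall B, measurable B -> m2 (g @^-1` B) <= c2%:E * n2 B)%E ->
  forall B, measurable B ->
  ((m1 \x m2) ((fun z => (f z.1, g z.2)) @^-1` B) <=
    (c1 * c2)%:E * (n1 \x n2) B)%E.
Proof.
move=> c10 c20 mf mg h1 h2 B mB; rewrite /product_measure1/=.
pose h : U1 -> \bar R := n2 \o xsection B.
have mh : measurable_fun [set: U1] h by exact: measurable_fun_xsection.
have h0 y : (0 <= h y)%E by exact: measure_ge0.
have mhf : measurable_fun setT (fun x => h (f x)) by apply: measurableT_comp.
have mBx y : measurable (xsection B y) by exact: measurable_xsection.
apply: (@le_trans _ _ (\int[m1]_x (c2%:E * h (f x)))%E).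
  apply: ge0_le_integral => //.
  - apply: (measurable_fun_xsection m2) => /=.
    rewrite -[X in measurable X]setTI; exact: measurable_pair_map.
  - exact: measurable_funeM.
  - by move=> x _ /=; rewrite preimage_xsection h2.
rewrite ge0_integralZl//.
rewrite (_ : (\int[m1]_x h (f x) = \int[pushforward m1 f]_x h x)%E); last first.
  by rewrite ge0_integral_pushforward// preimage_setT.
rewrite [(c1 * c2)%R]mulrC EFinM -muleA; apply: lee_wpmul2l; first by rewrite lee_fin.
rewrite -[c1]/((NngNum c10)%:num) -ge0_integral_mscale//.
exact: ge0_le_measure_integral.
Qed.

Lemma lebesgue_measure_shift (R : realType) (a : R) (A : set R) :
  measurable A ->
  pushforward lebesgue_measure (+%R^~ a : _ -> measurableTypeR R) A =
  lebesgue_measure A.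
Proof.
move=> mA; apply/esym/lebesgue_measure_unique => //=.
  exact: measurable_funD.
move=> mf _ [[b c]] /= _ <-; rewrite /pushforward.
have -> : (+%R^~ a) @^-1` `]b, c] = `]b - a, c - a]%classic.
  by apply/seteqP; split => x /=; rewrite !in_itv/= ltrBlDr lerBrDr.
rewrite !lebesgue_measure_itv/= !lte_fin ltrD2r.
by case: ifP => // _; rewrite -!EFinD; congr EFin; lra.
Qed.

Lemma normal_prob_shift (R : realType) (s a : R) (B : set R) :
    s != 0 -> measurable B ->
  normal_prob 0 s ((+%R^~ a) @^-1` B) = normal_prob a s B.
Proof.
move=> s0 mB; have ma : measurable_fun [set: R] (+%R^~ a : _ -> measurableTypeR R).
  exact: measurable_funD.
rewrite /normal_prob.
transitivity (\int[pushforward lebesgue_measure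
    (+%R^~ a : _ -> measurableTypeR R)]_(x in B) (normal_pdf a s x)%:E)%E.
  rewrite ge0_integral_pushforward//.
  - apply: eq_integral => x _ /=; congr EFin.
    by rewrite !normal_pdfE// /normal_fun addrK subr0.
  - apply/measurable_EFinP; apply: measurable_funS (measurable_normal_pdf _ _) => //.
  - by move=> x _; rewrite lee_fin normal_pdf_ge0.
by apply: eq_measure_integral => //= A mA _; exact: lebesgue_measure_shift.
Qed.

(** A variance below 1 gives lighter tails than the standard Gaussian, so the ratio of the densities
    is bounded, uniformly over shifts bounded by [b]. *)
Lemma normal_prob_shift_le (R : realType) (s b : R) : s != 0 -> s ^+ 2 < 1 ->
  exists2 c : R, 0 <= c & forall a : R, `|a| <= b -> forall B : set R, measurable B ->
    (normal_prob 0 s ((+%R^~ a) @^-1` B) <= c%:E * normal_prob 0 1 B)%E.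
Proof.
move=> s0 s1; have s20 : 0 < s ^+ 2 by rewrite exprn_even_gt0.
(* The ratio of the densities is largest at [x = a / (1 - s ^+ 2)], where it equals this expression
   with [a] in place of [b]. *)
exists (normal_peak s / normal_peak 1 * expR (b ^+ 2 / (1 - s ^+ 2) / 2)).
  by rewrite mulr_ge0 ?expR_ge0// divr_ge0 ?normal_peak_ge0.
set c := _ * expR _ => a ab B mB; rewrite normal_prob_shift//.
have c0 : 0 <= c by rewrite mulr_ge0 ?expR_ge0// divr_ge0 ?normal_peak_ge0.
rewrite /normal_prob -ge0_integralZl//; first last.
- by move=> x _; rewrite lee_fin normal_pdf_ge0.
- apply/measurable_EFinP; apply: measurable_funS (measurable_normal_pdf _ _) => //.
apply: ge0_le_integral => //.
- by move=> x _; rewrite lee_fin normal_pdf_ge0.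
- apply/measurable_EFinP; apply: measurable_funS (measurable_normal_pdf _ _) => //.
- apply: measurable_funeM; apply/measurable_EFinP.
  by apply: measurable_funS (measurable_normal_pdf _ _) => //.
move=> x _; rewrite -EFinM lee_fin !normal_pdfE ?oner_eq0//.
rewrite /c [leRHS]mulrACA divfK ?gt_eqF ?normal_peak_gt0 ?oner_eq0//.
rewrite -mulrA ler_wpM2l ?normal_peak_ge0// /normal_fun -expRD ler_expR.
have ab2 : a ^+ 2 <= b ^+ 2.
  by rewrite -[leLHS]real_normK ?num_real// ler_sqr ?nnegrE// (le_trans _ ab).
have t0 : 0 < 1 - s ^+ 2 by rewrite subr_gt0.
apply: (@le_trans _ _ (a ^+ 2 / (1 - s ^+ 2) / 2 + - x ^+ 2 / 2)); last first.
  rewrite subr0 expr1n; apply: lerD => //.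
  rewrite mulrA; apply: ler_wpM2r => //; apply: ler_wpM2r => //.
  by rewrite invr_ge0 ltW.
rewrite -subr_ge0 (_ : _ - _ =
    (a - x * (1 - s ^+ 2)) ^+ 2 / (s ^+ 2 * (1 - s ^+ 2) * 2)); last first.
  by rewrite -[s ^+ 2 *+ 2]mulr_natr; field; rewrite s0/= gt_eqF.
apply: divr_ge0; first exact: sqr_ge0.
by apply: mulr_ge0 => //; apply: mulr_ge0; exact: ltW.
Qed.


Definition cylinder (I T : Type) (B : I -> set T) : set (I -> T) :=
  [set y | forall i, B i (y i)].

Definition cylinders d (T : measurableType d) (I : Type) : set (set (I -> T)) :=
  [set A | exists2 B : I -> set T, (forall i, measurable (B i)) & A = cylinder B].

Section function_space.
Context d (T : measurableType d) (I : finType).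

Definition funspace := g_sigma_algebraType (@cylinders d T I).

HB.instance Definition _ := Measurable.on funspace.

Lemma measurable_cylinder (B : I -> set T) :
  (forall i, measurable (B i)) -> measurable (cylinder B : set funspace).
Proof. by move=> mB; apply: sub_sigma_algebra; exists B. Qed.

Lemma measurable_funspace d' (X : measurableType d') (f : X -> funspace) :
  (forall i, measurable_fun [set: X] (fun x => f x i)) ->
  measurable_fun [set: X] f.
Proof.
move=> mf;
  apply: (@measurability _ _ X funspace setT f (@cylinders d T I)) => // _ [_ [B mB ->] <-].
rewrite setTI; have -> : f @^-1` cylinder B =
    \bigcap_(i in [set: I]) ((fun x => f x i) @^-1` B i).
  by apply/seteqP; split => [x h i _|x h i]; [exact: h|exact: (h i Logic.I)].
apply: fin_bigcap_measurable; first exact: finite_finset.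
by move=> i _; rewrite -[X in measurable X]setTI; exact: mf.
Qed.

Lemma measurable_proj (i : I) : measurable_fun [set: funspace] (fun y => y i).
Proof.
move=> _ B mB; rewrite setTI.
rewrite (_ : _ @^-1` _ = cylinder (fun j => if j == i then B else setT)).
  by apply: measurable_cylinder => j; case: ifP.
apply/seteqP; split => y /= h; last by have := h i; rewrite eqxx.
by move=> j; case: ifP => // /eqP ->.
Qed.

(** Boxes are stable under intersection and include the whole space, so they determine a probability
    on the sigma-algebra they generate. *)
Lemma cylinder_measure_unique (R : realType) (P Q : probability funspace R) :
    (forall B : I -> set T, (forall i, measurable (B i)) ->
      P (cylinder B) = Q (cylinder B)) ->
  forall A, measurable A -> P A = Q A.
Proof.
move=> PQ A; apply: (@measure_unique _ R funspace (@cylinders d T I)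
  (fun=> setT) _ _ _ _ P Q) => //.
- move=> _ _ [B mB ->] [C mC ->]; exists (fun i => B i `&` C i).
    by move=> i; exact: measurableI.
  apply/seteqP; split => y /=; first by move=> [yB yC] i; split; auto.
  by move=> h; split => i; case: (h i).
- by move=> _; exists (fun=> setT) => //; apply/seteqP; split.
- by rewrite bigcup_const.
- by move=> _ [B mB ->]; exact: PQ.
- by move=> k; rewrite (le_lt_trans (probability_le1 _ _)) ?ltry.
Qed.

(* [nu] does not depend on the family [mu], which is what makes the bound
   uniform over shifts. *)
Lemma independent_dominated_exists (R : realType) (n : probability T R) (c : R)
    (y0 : T) : 0 <= c ->
  forall s : seq I, uniq s -> exists nu : probability funspace R,
    forall mu : I -> probability T R,
    (forall i B, measurable B -> mu i B <= c%:E * n B)%E ->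
    exists2 P : probability funspace R,
      (forall B : I -> set T, (forall i, measurable (B i)) ->
        P [set y | forall i, i \in s -> B i (y i)] = (\prod_(i <- s) mu i (B i))%E)
      & forall A, measurable A -> (P A <= (c ^+ size s)%:E * nu A)%E.
Proof.
move=> c0; elim=> [_|i s IH /= /andP[iNs us]].
  pose y : funspace := fun=> y0.
  exists (dirac y) => mu _; exists (dirac y).
    move=> B mB; rewrite big_nil (_ : [set _ | _] = setT) ?probability_setT//.
    by apply/seteqP; split.
  by move=> A mA; rewrite expr0 mul1e.
have [nu IHnu] := IH us.
(* Coordinates are added one at a time: [upd] overwrites coordinate [i] by a fresh independent
   variable, and coordinates outside the list keep the value [y0]. *)
pose upd (z : T * funspace) : funspace := fun j => if j == i then z.1 else z.2 j.
have mupd : measurable_fun [set: T * funspace] upd.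
  apply: measurable_funspace => j; rewrite /upd; case: (j == i).
    exact: measurable_fst.
  exact: measurableT_comp (measurable_proj j) measurable_snd.
pose u : {mfun (T * funspace)%type >-> funspace} := mfun_Sub (mem_set mupd).
exists (distribution (n \x nu)%E u) => mu mudom.
have [P Prect Pdom] := IHnu mu mudom.
exists (distribution (mu i \x P)%E u).
  move=> B mB; rewrite /distribution /pushforward big_cons -Prect//.
  rewrite -product_measure1E//; last first.
    rewrite (_ : [set _ | _] = cylinder (fun j => if j \in s then B j else setT)).
      by apply: measurable_cylinder => j; case: ifP.
    apply/seteqP; split => y /= h j; first by case: ifP => //; exact: h.
    by move=> js; have := h j; rewrite js.
  congr (product_measure1 _ _ _); apply/seteqP; split => [[x y]|[x y] [/= Bx By] j].
    move=> /= h; split => /=; first by have := h i; rewrite mem_head /upd eqxx; apply.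
    move=> j js; have := h j; rewrite inE js orbT /upd.
    by rewrite ifN; [apply|apply: contraNneq iNs => <-].
  by rewrite inE /upd/=; case: eqVneq => [-> _//|_ /=]; exact: By.
move=> A mA; rewrite /distribution /pushforward exprS.
have mA' : measurable (u @^-1` A) by have := mupd measurableT _ mA; rewrite setTI.
have /= := @product_measure_le _ _ _ _ _ _ _ _ R (mu i) P n nu c (c ^+ size s) id id
  c0 (exprn_ge0 _ c0) (@measurable_id _ _ _) (@measurable_id _ _ _) (mudom i) Pdom _ mA'.
by under eq_fun do rewrite -surjective_pairing.
Qed.

(** A law with independent coordinates agrees on boxes with the one built along [enum I], hence
    equals it and inherits its domination. *)
Lemma independent_dominated (R : realType) (n : probability T R) (c : R)
    (y0 : T) : 0 <= c ->
  exists nu : probability funspace R,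
    forall (mu : I -> probability T R) (P : probability funspace R),
    (forall i B, measurable B -> mu i B <= c%:E * n B)%E ->
    (forall B : I -> set T, (forall i, measurable (B i)) ->
      P (cylinder B) = (\prod_i mu i (B i))%E) ->
    forall A, measurable A -> (P A <= (c ^+ #|I|)%:E * nu A)%E.
Proof.
move=> c0.
have [nu nuP] := independent_dominated_exists n y0 c0 (enum_uniq I).
exists nu => mu P mun Pcyl A mA; have [Q Qcyl Qdom] := nuP mu mun.
rewrite cardE; apply: le_trans (Qdom A mA).
rewrite le_eqVlt; apply/orP; left; apply/eqP; apply: cylinder_measure_unique => // B mB.
rewrite Pcyl// -big_enum -Qcyl//; congr (_ _).
apply/seteqP; split => y /= h i; last by move=> _; exact: (h i).
by apply: h; rewrite mem_enum.
Qed.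

End function_space.

(** * Gaussian noise and quantized signals *)

Definition translate (R : realType) (a z : R * R) : R * R :=
  (z.1 + a.1, z.2 + a.2).

Lemma measurable_translate (R : realType) (a : R * R) :
  measurable_fun [set: R * R] (translate a).
Proof.
apply: (@measurable_pair_map _ _ _ _ R R R R (+%R^~ a.1) (+%R^~ a.2));
  exact: measurable_funD.
Qed.

Lemma CN01_shift_le (R : realType) (b : R) :
  exists2 c : R, 0 < c & exists n : probability (R * R)%type R,
    forall a : R * R, `|a.1| <= b -> `|a.2| <= b -> forall B, measurable B ->
    (@CN01 R (translate a @^-1` B) <= c%:E * n B)%E.
Proof.
have s0 : Num.sqrt (2^-1 : R) != 0 by rewrite gt_eqF// sqrtr_gt0 invr_gt0.
have s1 : Num.sqrt (2^-1 : R) ^+ 2 < 1.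
  by rewrite sqr_sqrtr ?invr_ge0// invf_lt1// ltr1n.
have [c c0 cP] := normal_prob_shift_le b s0 s1.
(* One factor [c] for each of the real and imaginary parts; adding 1 makes the constant positive, so
   that the logarithm of its powers can be expanded. *)
exists (c * c + 1); first by rewrite ltr_wpDl ?mulr_ge0.
pose N1 : probability _ R := normal_prob (0 : R) 1.
pose Ns : probability _ R := normal_prob (0 : R) (Num.sqrt 2^-1).
(* [normal_prob] lives on [measurableTypeR R], which has the same measurable
   sets as [R] but is another structure. *)
pose T2 := (measurableTypeR R * measurableTypeR R)%type.
have mid : @measurable_fun _ _ T2 (R * R)%type setT (fun z => z).
  by move=> _ B mB; rewrite setTI.
pose N2 : probability T2 R := [the probability _ R of (N1 \x N1)%E].
pose idm : {mfun T2 >-> (R * R)%type} :=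
  @mfun_Sub _ _ T2 (R * R)%type (fun z => z) (mem_set mid).
exists [the probability _ R of distribution N2 idm] => a a1 a2 B mB.
apply: (@le_trans _ _ ((c * c)%:E * (N1 \x N1) B)%E); last first.
  by rewrite lee_wpmul2r ?measure_ge0// lee_fin lerDl.
rewrite /CN01.
apply: (@product_measure_le _ _ _ _ _ _ _ _ R Ns Ns N1 N1 c c
  (+%R^~ a.1) (+%R^~ a.2)) => //.
- exact: measurable_funD.
- exact: measurable_funD.
- exact: cP.
- exact: cP.
Qed.

Lemma CN01_setT (R : realType) : @CN01 R setT = 1%E.
Proof.
pose Ns : probability _ R := normal_prob (0 : R) (Num.sqrt 2^-1).
exact: (probability_setT [the probability _ R of (Ns \x Ns)%E]).
Qed.

(** The order of the quantifiers matters: [c] depends on [b] only and [nu] on [b] and [I] only, so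
    one measure serves all shifts, which will vary with the library. *)
Lemma noise_dominated (R : realType) (b : R) :
  exists2 c : R, 0 < c & forall I : finType,
    exists nu : probability (funspace (R * R)%type I) R,
    forall (d : measure_display) (Omega : measurableType d)
      (P : probability Omega R) (Z : I -> Omega -> R * R),
    (forall i, measurable_fun [set: Omega] (Z i)) ->
    (forall B : I -> set (R * R), (forall i, measurable (B i)) ->
      P [set w | forall i, B i (Z i w)] = (\prod_i @CN01 R (B i))%E) ->
    forall a : I -> R * R, (forall i, `|(a i).1| <= b /\ `|(a i).2| <= b) ->
    forall A : set (funspace (R * R)%type I), measurable A ->
      measurable [set w | A (fun i => translate (a i) (Z i w))] /\
      (P [set w | A (fun i => translate (a i) (Z i w))] <=
        (c ^+ #|I|)%:E * nu A)%E.
Proof.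
have [c c0 [n cP]] := CN01_shift_le b; exists c => // I.
have [nu nuP] := independent_dominated I n (0, 0) (ltW c0).
exists nu => d Omega P Z mZ Zind a ab A mA.
pose sh (i : I) := translate (a i).
have msh i : measurable_fun [set: R * R] (sh i).
  exact: measurable_translate.
have mZi i : measurable_fun [set: Omega] (fun w => sh i (Z i w)).
  exact: measurableT_comp (msh i) (mZ i).
pose X (w : Omega) : funspace (R * R)%type I := fun i => sh i (Z i w).
have mX : measurable_fun [set: Omega] X by exact: measurable_funspace.
have mXA : measurable (X @^-1` A) by have := mX measurableT _ mA; rewrite setTI.
split => //.
pose X' : {mfun Omega >-> funspace (R * R)%type I} := mfun_Sub (mem_set mX).
pose Y i : {mfun Omega >-> (R * R)%type} := mfun_Sub (mem_set (mZi i)).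
apply: (nuP (fun i => distribution P (Y i)) (distribution P X')) => //.
- move=> i B mB; have [a1 a2] := ab i.
  apply: le_trans (cP (a i) a1 a2 B mB).
  rewrite /distribution /pushforward/=.
  pose C j : set (R * R) := if j == i then sh i @^-1` B else setT.
  have mC j : measurable (C j).
    by rewrite /C; case: ifP => // _; have := msh i measurableT _ mB; rewrite setTI.
  have := Zind C mC.
  rewrite (bigD1 i)//= big1 ?mule1; last first.
    by move=> j /negbTE ji; rewrite /C ji CN01_setT.
  rewrite /C eqxx => <-; rewrite le_eqVlt; apply/orP; left; apply/eqP.
  congr (P _); apply/seteqP; split => w /=; last by move/(_ i); rewrite eqxx.
  by move=> h j; case: ifP => // /eqP ->.
- move=> B mB; rewrite /distribution /pushforward/=.
  have mC j : measurable (sh j @^-1` B j).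
    by have := msh j measurableT _ (mB j); rewrite setTI.
  apply: (etrans (Zind (fun i => sh i @^-1` B i) mC)); apply: eq_bigr => i _.
  pose C j : set (R * R) := if j == i then sh i @^-1` B i else setT.
  have mC' j : measurable (C j) by rewrite /C; case: ifP.
  have := Zind C mC'.
  rewrite (bigD1 i)//= big1 ?mule1; last first.
    by move=> j /negbTE ji; rewrite /C ji CN01_setT.
  rewrite /C eqxx => <-.
  congr (P _); apply/seteqP; split => w /=; first by move/(_ i); rewrite eqxx.
  by move=> h j; case: ifP => // /eqP ->.
Qed.

(** * Lattice weights and the converse for rounded real signals *)

Lemma sum_grid_weight_le (R : realType) (q : R) (A : nat) : 1 <= q ->
  \sum_(n < A) (1 + n%:R / q) ^- 2 <= 2 * q.
Proof.
move=> q1; have q0 : 0 < q by rewrite (lt_le_trans _ q1).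
case: A => [|A]; first by rewrite big_ord0 mulr_ge0// ltW.
(* A sharper bound suited to induction: with [a = q + A%:R], the new term [q ^+ 2 / (a + 1) ^+ 2] is
   at most [q ^+ 2 / a - q ^+ 2 / (a + 1)], which telescopes. *)
apply: (@le_trans _ _ (1 + q - q ^+ 2 / (q + A%:R))); last first.
  have : 0 <= q ^+ 2 / (q + A%:R) by rewrite divr_ge0 ?sqr_ge0// addr_ge0// ltW.
  lra.
elim: A => [|A IH].
  rewrite big_ord1 mul0r addr0 expr1n invr1 addr0 expr2 mulfK ?gt_eqF//; lra.
rewrite big_ord_recr/=; apply: (le_trans (lerD IH (lexx _))).
set a := q + A%:R; have a0 : 0 < a by rewrite ltr_wpDr.
have -> : q + A.+1%:R = a + 1 by rewrite -natr1 addrA.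
have -> : 1 + A.+1%:R / q = (a + 1) / q.
  by rewrite -natr1 /a; field; rewrite gt_eqF.
have a10 : 0 < a + 1 by rewrite addr_gt0.
have -> : ((a + 1) / q) ^- 2 = q ^+ 2 / (a + 1) ^+ 2.
  by field; rewrite !gt_eqF.
have : 0 <= q ^+ 2 / (a * (a + 1) ^+ 2).
  by rewrite divr_ge0 ?sqr_ge0// mulr_ge0 ?sqr_ge0// ltW.
have -> : q ^+ 2 / (a * (a + 1) ^+ 2) =
    q ^+ 2 / a - q ^+ 2 / (a + 1) - q ^+ 2 / (a + 1) ^+ 2.
  by field; rewrite !gt_eqF.
lra.
Qed.

(** [2 * ln (1 + u) <= 2 * u <= 1 + u ^+ 2]; a quadratic bound lets the power constraint control the
    log-weights. *)
Lemma ln_grid_weight_ge (R : realType) (u : R) : 0 <= u ->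
  - ln ((1 + u) ^- 2) <= 1 + u ^+ 2.
Proof.
move=> u0; have u10 : 0 < 1 + u by rewrite ltr_wpDr.
rewrite lnV ?posrE ?exprn_gt0// opprK lnXn//.
have := @le_ln1Dx R u (lt_le_trans (ltrN10 _) u0); have := sqr_ge0 (u - 1).
by rewrite sqrrB1 mulr2n; lra.
Qed.

Lemma ln_prod (R : realType) (I : finType) (F : I -> R) :
  (forall i, 0 < F i) -> ln (\prod_i F i) = \sum_i ln (F i).
Proof.
move=> F0; suff [] : 0 < \prod_i F i /\ ln (\prod_i F i) = \sum_i ln (F i) by [].
elim/big_rec2: _ => [|i y z _ [z0 <-]]; first by rewrite ln1.
by rewrite mulr_gt0 ?F0// lnM ?posrE ?F0.
Qed.

Lemma measurable_borel_preimage (R : realType) (n : nat) d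
    (X : measurableType d) (g : X -> 'rV[R[i]]_n) (A : set 'rV[R[i]]_n) :
    (forall t, measurable_fun [set: X] (fun x => reim (g x 0 t))) ->
  borel_rV A -> measurable (g @^-1` A).
Proof.
move=> mg bA; rewrite -[X in measurable X]setTI.
suff : image_set_system setT g measurable A by [].
move: A bA; apply: smallest_sub.
  by apply: sigma_algebra_image; exact: sigma_algebra_measurable.
elim/big_ind: _ => [|S1 S2 h1 h2 A [/h1//|/h2//]|t _ _ [B mB <-]]//.
rewrite /image_set_system/= !setTI.
by have := mg t measurableT _ mB; rewrite setTI.
Qed.

(** Rounding toward zero, by sign and magnitude, never increases the modulus. [A] makes the alphabet
    finite; [inord] sends magnitudes beyond [A] to 0, so [A] has to be at least the truncated
    modulus. *)
Definition grid_code (R : realType) (A : nat) (a : R) : bool * 'I_A.+1 :=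
  (a < 0, inord (Num.truncn `|a|)).

Definition grid_point (R : realType) (A : nat) (s : bool * 'I_A.+1) : R :=
  (-1) ^+ s.1 * s.2%:R.

Lemma grid_code_val (R : realType) (A : nat) (a : R) :
    (Num.truncn `|a| <= A)%N ->
  (grid_code A a).2%:R <= `|a| /\ `|a - grid_point R (grid_code A a)| <= 1.
Proof.
move=> aA; rewrite /grid_point/grid_code/= inordK ?ltnS//.
have /andP[l u] := truncn_itv (normr_ge0 a); split => //.
rewrite -natr1 in u.
have [a0|a0] := ltP a 0.
  by rewrite expr1 mulN1r opprK ler_norml; rewrite ltr0_norm// in l u *; lra.
by rewrite expr0 mul1r ler_norml; rewrite ger0_norm// in l u *; lra.
Qed.

Section signal_converse.
Variables (R : realType) (K N : nat) (J : finType) (alpha beta : 'I_K -> J -> R).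

(** Bounds how far the real and imaginary parts received by any user move when each real signal
    moves by at most 1. *)
Let b := \sum_k \sum_j (`|alpha k j| + `|beta k j|).

Definition noisy_row (TE : nat) (x : J -> 'I_TE -> R) (z : 'I_K * 'I_TE -> R * R)
    (k : 'I_K) : 'rV[R[i]]_TE :=
  \row_t Complex (\sum_j alpha k j * x j t + (z (k, t)).1)
                 (\sum_j beta k j * x j t + (z (k, t)).2).

Lemma shift_le (x : J -> R) (k : 'I_K) : (forall j, `|x j| <= 1) ->
  `|\sum_j alpha k j * x j| <= b /\ `|\sum_j beta k j * x j| <= b.
Proof.
move=> x1.
have bk : \sum_j (`|alpha k j| + `|beta k j|) <= b.
  rewrite /b [leRHS](bigD1 k)//= lerDl; apply: sumr_ge0 => i _.
  by apply: sumr_ge0 => j _; rewrite addr_ge0.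
have xj (a : R) j : `|a * x j| <= `|a|.
  by rewrite normrM ler_piMr.
split; apply: le_trans bk; apply: le_trans (ler_norm_sum _ _ _) _.
  by apply: ler_sum => j _; rewrite (le_trans (xj _ _))// lerDl.
by apply: ler_sum => j _; rewrite (le_trans (xj _ _))// lerDr.
Qed.

Lemma measurable_noisy_row (TE : nat) (x : J -> 'I_TE -> R)
    (dec : 'I_K -> 'rV[R[i]]_TE -> Prop) :
    (forall k, borel_rV [set y | dec k y]) ->
  measurable ([set z : funspace (R * R)%type ('I_K * 'I_TE)%type |
    forall k, dec k (noisy_row x z k)]).
Proof.
move=> mdec.
rewrite (_ : [set _ | _] = \bigcap_(k in [set: 'I_K])
    ((fun z : funspace (R * R)%type ('I_K * 'I_TE)%type => noisy_row x z k) @^-1`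
      [set y | dec k y])); last first.
  by apply/seteqP; split => [z h k _|z h k]; [exact: h|exact: (h k Logic.I)].
apply: fin_bigcap_measurable; first exact: finite_finset.
move=> k _; apply: measurable_borel_preimage (mdec k) => t.
rewrite (_ : (fun _ => _) = (fun z : funspace (R * R)%type ('I_K * 'I_TE)%type =>
    translate (\sum_j alpha k j * x j t, \sum_j beta k j * x j t) (z (k, t)))).
  exact: measurableT_comp (measurable_translate _) (measurable_proj _).
by apply/funext => z; rewrite /noisy_row mxE /reim/= /translate/=; congr pair;
  exact: addrC.
Qed.

(** [c] is fixed before the alphabet and the block length. Per symbol, [ln c] pays for dominating
    the shifted noise of a user, [ln (4 * q)] for the total weight of a real signal, and the
    quotient by [1 - e] for the averaged log-weights under the power constraint. *)
Lemma signal_converse :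
  exists2 c : R, 0 < c &
  forall (T : finType) (TE : nat) (D : 'I_K -> 'I_N)
    (x : {ffun 'I_N -> T} -> J -> 'I_TE -> R)
    (dec : 'I_K -> 'rV[R[i]]_TE -> T)
    d (Omega : measurableType d) (P : probability Omega R)
    (Z : 'I_K * 'I_TE -> Omega -> R * R) (q s e : R),
    injective D -> (0 < #|T|)%N -> 1 <= q -> e < 1 ->
    (forall i, measurable_fun [set: Omega] (Z i)) ->
    (forall B : 'I_K * 'I_TE -> set (R * R), (forall i, measurable (B i)) ->
      P [set w | forall i, B i (Z i w)] = (\prod_i @CN01 R (B i))%E) ->
    (forall k j, borel_rV [set y | dec k y = j]) ->
    (forall f, \sum_j \sum_t x f j t ^+ 2 <= TE%:R * s * q ^+ 2) ->
    (1 - e) * #|{: {ffun 'I_N -> T}}|%:R <=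
      \sum_f fine (P [set w | forall k,
         dec k (noisy_row (x f) (Z ^~ w) k) = f (D k)]) ->
  K%:R * ln (#|T|%:R : R) <= TE%:R * (K%:R * ln c + #|J|%:R * ln (4 * q)
    + (#|J|%:R + s) / (1 - e)) - ln (1 - e).
Proof.
have [c c0 cP] := noise_dominated b; exists c => // T TE D x dec d Omega P Z q s e.
move=> injD T0 q1 e1 mZ Zind mdec xpow sp.
have q0 : 0 < q by exact: lt_le_trans q1.
have e1' : 0 < 1 - e by rewrite subr_gt0.
have [nu /(_ _ _ P Z mZ Zind) nuP] := cP ('I_K * 'I_TE)%type.
(* One finite alphabet for all rounded codewords; its size disappears later, as [sum_grid_weight_le]
   is uniform in [A]. *)
pose A := \max_f \max_j \max_t Num.truncn `|x f j t|.
have xA f j t : (Num.truncn `|x f j t| <= A)%N.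
  apply: leq_trans (leq_bigmax f); apply: leq_trans (leq_bigmax j).
  exact: (leq_bigmax t).
pose V := {ffun J * 'I_TE -> bool * 'I_A.+1}.
pose v f : V := [ffun jt => grid_code A (x f jt.1 jt.2)].
pose w (y : V) : R := \prod_jt (1 + (y jt).2%:R / q) ^- 2.
pose xh (y : V) (j : J) (t : 'I_TE) : R := grid_point R (y (j, t)).
(* Correct decoding from the rounded signals: [z] and [v f] determine what is decoded, so libraries
   with the same [v] and different demanded files have disjoint events. *)
pose E (f : {ffun 'I_N -> T}) : set (funspace (R * R)%type ('I_K * 'I_TE)%type) :=
  [set z | forall k, dec k (noisy_row (xh (v f)) z k) = f (D k)].
have mE f : measurable (E f).
  by apply: (@measurable_noisy_row TE (xh (v f)) (fun k y => dec k y = f (D k))).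
have fac1 (n : nat) : 1 <= 1 + n%:R / q by rewrite lerDl divr_ge0// ltW.
have fac n : 0 < (1 + n%:R / q) ^- 2 <= 1.
  rewrite invr_gt0 exprn_gt0 ?(lt_le_trans _ (fac1 n))//=.
  by rewrite invf_le1 ?exprn_gt0 ?(lt_le_trans _ (fac1 n))// exprn_ege1.
have w01 y : 0 < w y <= 1.
  rewrite prodr_gt0/=; last by move=> i _; case/andP: (fac (y i).2).
  by apply: prodr_ile1 => i _; case/andP: (fac (y i).2) => /ltW -> ->.
pose p f := fine (P [set w | forall k, dec k (noisy_row (x f) (Z ^~ w) k) = f (D k)]).
(* The rounding error is moved into the noise: the received signal is the rounded one plus noise
   translated by [a f]. *)
pose a f (kt : 'I_K * 'I_TE) : R * R :=
  (\sum_j alpha kt.1 j * (x f j kt.2 - xh (v f) j kt.2),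
   \sum_j beta kt.1 j * (x f j kt.2 - xh (v f) j kt.2)).
have ab f i : `|(a f i).1| <= b /\ `|(a f i).2| <= b.
  apply: shift_le => j; rewrite /xh ffunE /=.
  by have [] := grid_code_val (xA f j i.2).
have sumE f (g : J -> R) t : \sum_j g j * xh (v f) j t +
    \sum_j g j * (x f j t - xh (v f) j t) = \sum_j g j * x f j t.
  by rewrite -big_split; apply: eq_bigr => j _; rewrite /= -mulrDr addrC subrK.
have eqE f : [set w | forall k, dec k (noisy_row (x f) (Z ^~ w) k) = f (D k)] =
    [set w | E f (fun i => translate (a f i) (Z i w))].
  apply/seteqP; rewrite /E; split => om /= h k; rewrite -(h k); congr (dec k _);
  by apply/rowP => t; rewrite !mxE /translate/=; congr Complex; rewrite -(sumE f); ring.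
have dE f g : v f = v g -> f != g ->
    (forall n, n \notin codom D -> f n = g n) -> E f `&` E g = set0.
  move=> vfg fg off; apply/seteqP; split => // z [Ef Eg]; case/negP: fg; apply/eqP.
  apply/ffunP => n; have [/codomP[k ->]|/off//] := boolP (n \in codom D).
  by rewrite -(Ef k) -(Eg k) vfg.
have p01 f : 0 <= p f <= 1.
  rewrite fine_ge0// -lee_fin fineK ?fin_num_measure//; last first.
    by rewrite eqE; have [] := nuP (a f) (ab f) (E f) (mE f).
  by apply: probability_le1; rewrite eqE; have [] := nuP (a f) (ab f) (E f) (mE f).
have pE f : p f <= c ^+ #|{: 'I_K * 'I_TE}| * fine (nu (E f)).
  have [m le] := nuP (a f) (ab f) (E f) (mE f).
  rewrite /p eqE -lee_fin EFinM !fineK ?fin_num_measure//.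
have w_ge0 y : 0 <= w y by case/andP: (w01 y) => /ltW.
have := decoding_bound injD T0 (exprn_ge0 _ (ltW c0)) e1 mE w_ge0
  (fun f => w01 (v f)) dE p01 pE sp.
move=> /le_trans; apply.
rewrite lnXn// card_prod !card_ord -[ln c *+ _]mulr_natl natrM.
(* The weight factors over the [#|J| * TE] real symbols, each contributing at most [4 * q]: two
   signs times [2 * q]. *)
have sumw : ln (\sum_y w y) <= (#|J| * TE)%:R * ln (4 * q).
  have -> : \sum_y w y =
      (\sum_(sn : bool * 'I_A.+1) (1 + sn.2%:R / q) ^- 2) ^+ (#|J| * TE).
    rewrite -(bigA_distr_bigA (fun _ (sn : bool * 'I_A.+1) => (1 + sn.2%:R / q) ^- 2)).
    by rewrite prodr_const cardT -cardE card_prod card_ord.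
  have -> : \sum_(sn : bool * 'I_A.+1) (1 + sn.2%:R / q) ^- 2 =
      2 * \sum_(n < A.+1) (1 + n%:R / q) ^- 2.
    rewrite -(pair_bigA _ (fun (_ : bool) (n : 'I_A.+1) => (1 + n%:R / q) ^- 2))/=.
    by rewrite sumr_const card_bool mulr_natl.
  have S0 : 0 < \sum_(n < A.+1) (1 + n%:R / q) ^- 2.
    rewrite big_ord_recl/= ltr_pwDl//; first by case/andP: (fac 0%N).
    by apply: sumr_ge0 => i _; case/andP: (fac (lift ord0 i)) => /ltW.
  rewrite lnXn ?mulr_gt0// -[leLHS]mulr_natl ler_wpM2l// ler_ln ?posrE ?mulr_gt0//.
  have := sum_grid_weight_le A.+1 q1; lra.
have lnw f : - ln (w (v f)) <= TE%:R * (#|J|%:R + s).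
  have -> : ln (w (v f)) = \sum_jt ln ((1 + (v f jt).2%:R / q) ^- 2).
    by apply: ln_prod => jt; case/andP: (fac (v f jt).2).
  rewrite -sumrN.
  apply: (@le_trans _ _ (\sum_jt (1 + (x f jt.1 jt.2 / q) ^+ 2))).
    apply: ler_sum => jt _.
    apply: (le_trans (ln_grid_weight_ge _)); first by rewrite divr_ge0// ltW.
    rewrite lerD2l -[leRHS]real_normK ?num_real// ler_sqr ?nnegrE ?divr_ge0 ?(ltW q0)//.
    rewrite normrM [`|q^-1|]gtr0_norm ?invr_gt0// ler_pM2r ?invr_gt0// ffunE.
    by have [] := grid_code_val (xA f jt.1 jt.2).
  rewrite big_split/= sumr_const card_prod card_ord -mulr_natl mulr1 natrM mulrDr.
  rewrite [leLHS]addrC [leRHS]addrC [#|J|%:R * _]mulrC lerD2r.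
  rewrite -(pair_bigA _ (fun j t => (x f j t / q) ^+ 2))/=.
  under eq_bigr do under eq_bigr do rewrite exprMn exprVn.
  under eq_bigr do rewrite -mulr_suml.
  by rewrite -mulr_suml ler_pdivrMr ?exprn_gt0.
have avg : - (#|{: {ffun 'I_N -> T}}|%:R^-1 * \sum_f ln (w (v f))) <=
    TE%:R * (#|J|%:R + s).
  have F0 : 0 < (#|{: {ffun 'I_N -> T}}|%:R : R).
    by rewrite card_ffun natrX exprn_gt0// ltr0n.
  rewrite -mulrN mulrC ler_pdivrMr// -sumrN.
  apply: (@le_trans _ _ (\sum_(f : {ffun 'I_N -> T}) TE%:R * (#|J|%:R + s))).
    by apply: ler_sum => f _; exact: lnw.
  by rewrite sumr_const -[leLHS]mulr_natr.
have := ler_wpM2r (ltW (_ : 0 < (1 - e)^-1)) avg.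
rewrite invr_gt0 => /(_ e1'); rewrite mulNr -mulrA => avg'.
rewrite natrM in sumw.
lra.
Qed.

End signal_converse.

(** * Converse bounds for a single policy *)

Lemma Re_mulc (R : realType) (a b : R[i]) :
  complex.Re (a * b) = complex.Re a * complex.Re b - complex.Im a * complex.Im b.
Proof. by case: a b => [a1 a2] [b1 b2]. Qed.

Lemma Im_mulc (R : realType) (a b : R[i]) :
  complex.Im (a * b) = complex.Re a * complex.Im b + complex.Im a * complex.Re b.
Proof. by case: a b => [a1 a2] [b1 b2]. Qed.

Lemma Re_addc (R : realType) (a b : R[i]) :
  complex.Re (a + b) = complex.Re a + complex.Re b.
Proof. by case: a b => [a1 a2] [b1 b2]. Qed.

Lemma Im_addc (R : realType) (a b : R[i]) :
  complex.Im (a + b) = complex.Im a + complex.Im b.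
Proof. by case: a b => [a1 a2] [b1 b2]. Qed.

Lemma Re_sum (R : realType) (I : Type) (s : seq I) (F : I -> R[i]) :
  complex.Re (\sum_(i <- s) F i) = \sum_(i <- s) complex.Re (F i).
Proof. by apply: big_morph => //; exact: Re_addc. Qed.

Lemma Im_sum (R : realType) (I : Type) (s : seq I) (F : I -> R[i]) :
  complex.Im (\sum_(i <- s) F i) = \sum_(i <- s) complex.Im (F i).
Proof. by apply: big_morph => //; exact: Im_addc. Qed.

Lemma sqr_sum_le (R : realType) (n : nat) (y : 'I_n -> R) :
  (\sum_i y i) ^+ 2 <= n%:R * \sum_i y i ^+ 2.
Proof.
have <- : \sum_(i < n) \sum_(j < n) (y i ^+ 2 + y j ^+ 2) / 2 =
    n%:R * \sum_i y i ^+ 2.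
  under eq_bigr do rewrite -mulr_suml big_split/= sumr_const card_ord.
  rewrite -mulr_suml big_split/= sumrMnl sumr_const card_ord -mulr2n.
  by rewrite -[_ *+ 2]mulr_natr mulfK ?pnatr_eq0// mulr_natl.
rewrite expr2 mulr_suml; apply: ler_sum => i _; rewrite mulr_sumr.
by apply: ler_sum => j _; have := sqr_ge0 (y i - y j); rewrite sqrrB; lra.
Qed.

Definition csqr (R : realType) (z : R[i]) : R :=
  complex.Re z ^+ 2 + complex.Im z ^+ 2.

Lemma csqr_sumM_le (R : realType) (n : nat) (h x : 'I_n -> R[i]) :
  csqr (\sum_i h i * x i) <= n%:R * \sum_i csqr (h i) * csqr (x i).
Proof.
rewrite /csqr Re_sum Im_sum.
apply: (le_trans (lerD (sqr_sum_le _) (sqr_sum_le _))).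
rewrite -mulrDr ler_wpM2l// -big_split/=; apply: ler_sum => i _.
by rewrite Re_mulc Im_mulc le_eqVlt; apply/orP; left; apply/eqP; ring.
Qed.

Lemma sum_pair_bool (R : realType) (n : nat) (F : 'I_n * bool -> R) :
  \sum_j F j = \sum_i (F (i, false) + F (i, true)).
Proof.
rewrite (eq_bigr (fun j => F (j.1, j.2))); last by case.
rewrite -(pair_bigA _ (fun i b => F (i, b)))/=; apply: eq_bigr => i _.
by rewrite big_bool addrC.
Qed.

Lemma measure_bigsetU_le d (T : measurableType d) (R : realType)
    (mu : {measure set T -> \bar R}) (I : Type) (s : seq I) (E : I -> set T) :
    (forall i, measurable (E i)) ->
  (mu (\big[setU/set0]_(i <- s) E i) <= \sum_(i <- s) mu (E i))%E.
Proof.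
move=> mE; elim: s => [|i s IH]; first by rewrite !big_nil measure0.
rewrite !big_cons; apply: (le_trans (measureU2 _ _ _)) => //.
  exact: bigsetU_measurable.
by rewrite leeD2l.
Qed.

Section policy_bounds.
Variables (R : realType) (K M N : nat).
Variables (dZ : measure_display) (OmegaZ : measurableType dZ)
  (PZ : probability OmegaZ R) (Z : 'I_K * nat -> OmegaZ -> R[i]).
Hypothesis Z_iid : iid PZ Z (@CN01 R).

Section one_policy.
Variables (mu CF P : R) (L : nat) (p : policy K M N mu CF P L).
Variables (D : demand K N) (H : channel R K M).

Definition success (f : library N L) : set OmegaZ :=
  [set w | forall k, decoder k (received p f D H (fun t => Z (k, t) w) k) (D k) H
                     = f (D k)].

Let dec_event f k : set OmegaZ :=
  [set w | decoder k (received p f D H (fun t => Z (k, t) w) k) (D k) H = f (D k)].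

Lemma measurable_dec_event f k : measurable (dec_event f k).
Proof.
have [mZ _] := Z_iid.
pose g w := received p f D H (fun t => Z (k, t) w) k.
have mg t : measurable_fun [set: OmegaZ] (fun w => reim (g w 0 t)).
  set v := \sum_m H k m * codeword p f D H m 0 t.
  rewrite (_ : (fun _ => _) = (fun w => translate (reim v) (reim (Z (k, val t) w)))).
    exact: measurableT_comp (measurable_translate _) (mZ _).
  apply/funext => w; rewrite /g /received mxE -/v /reim/= Re_addc Im_addc /translate/=.
  by congr pair; exact: addrC.
exact: (measurable_borel_preimage mg
  (@decoder_measurable _ _ _ _ _ _ _ _ p k (D k) H (f (D k)))).
Qed.

Lemma successE f : success f = \bigcap_(k in [set: 'I_K]) dec_event f k.
Proof. by apply/seteqP; split => [w h k _|w h k]; [exact: h|exact: (h k Logic.I)]. Qed.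

Lemma measurable_success f : measurable (success f).
Proof.
rewrite successE; apply: fin_bigcap_measurable; first exact: finite_finset.
by move=> k _; exact: measurable_dec_event.
Qed.

Lemma prob_success_ge f :
  1 - \sum_k fine (PZ (~` dec_event f k)) <= fine (PZ (success f)).
Proof.
have -> : fine (PZ (success f)) = 1 - fine (PZ (~` success f)).
  rewrite probability_setC ?fineB ?fin_num_measure//; last 2 first.
  - exact: measurable_success.
  - exact: measurable_success.
  by rewrite /= opprB addrC subrK.
rewrite lerD2l lerN2 -lee_fin -sumEFin fineK; last first.
  by rewrite fin_num_measure//; apply: measurableC; exact: measurable_success.
have mC k : measurable (~` dec_event f k).
  by apply: measurableC; exact: measurable_dec_event.
under eq_bigr do rewrite fineK ?fin_num_measure//.
have -> : ~` success f = \big[setU/set0]_k ~` dec_event f k.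
  rewrite successE setC_bigcap -bigcup_seq.
  by apply/seteqP; split => w [k _ wk]; exists k => //; exact: mem_index_enum.
exact: measure_bigsetU_le.
Qed.

Lemma sum_success_ge (e : R) : injective D ->
    (error_prob p PZ Z H <= e%:E)%E ->
  (1 - K%:R * e) * #|{: library N L}|%:R <= \sum_f fine (PZ (success f)).
Proof.
move=> injD he.
apply: le_trans (ler_sum _ (fun f _ => prob_success_ge f)).
rewrite sumrB sumr_const mulrBl mul1r lerD2l lerN2.
have F0 : 0 < (#|{: library N L}|%:R : R).
  by rewrite card_ffun !card_ord natrX exprn_gt0// ltr0n expn_gt0.
rewrite exchange_big/= -mulrA.
apply: (@le_trans _ _ (\sum_(k < K) e * #|{: library N L}|%:R)); last first.
  by rewrite sumr_const card_ord -[leLHS]mulr_natl.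
apply: ler_sum => k _; rewrite -ler_pdivrMr// mulrC.
have : (user_error p PZ Z H D k <= e%:E)%E.
  apply: le_trans he; rewrite /error_prob.
  apply: le_trans (le_bigmax _ _ D); exact: (le_bigmax _ _ k).
rewrite /user_error -lee_fin EFinM -sumEFin.
apply: le_trans; rewrite le_eqVlt; apply/orP; left; apply/eqP.
congr (_ * _)%E; apply: eq_bigr => f _; rewrite fineK//.
by rewrite fin_num_measure//; apply: measurableC; exact: measurable_dec_event.
Qed.
End one_policy.
End policy_bounds.

Lemma nln1B_le (R : realType) (x : R) : x <= 2^-1 -> - ln (1 - x) <= ln 2.
Proof.
move=> x2; have x1 : 0 < 1 - x by lra.
rewrite -lnV ?posrE// ler_ln ?posrE ?invr_gt0//.
by rewrite -[leRHS]invrK lef_pV2 ?posrE ?invr_gt0//; lra.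
Qed.

Section edge_bound.
Variables (R : realType) (K M N : nat) (K_le_N : (K <= N)%N).
Variables (dZ : measure_display) (OmegaZ : measurableType dZ)
  (PZ : probability OmegaZ R) (Z : 'I_K * nat -> OmegaZ -> R[i]).
Hypothesis Z_iid : iid PZ Z (@CN01 R).
Variable H : channel R K M.

(** A demand of distinct files; since [error_prob] is a maximum over demands, it also bounds the
    error at this one. *)
Let D : demand K N := [ffun k => widen_ord K_le_N k].

Lemma widen_demand_inj : injective D.
Proof. by move=> k l; rewrite !ffunE => /(congr1 val)/= /val_inj. Qed.

(** Common core of the cases [M <= K] and [K < M]. With [q = Num.sqrt P] each real signal
    contributes [ln P / 2] per symbol, hence [#|J|%:R / 2]; [C] may depend on [H] but not on [P] or
    [L]. *)
Lemma edge_bound_of_signals (J : finType) (alpha beta : 'I_K -> J -> R) (s : R)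
    (x : forall n, ('I_M -> 'rV[R[i]]_n) -> J -> 'I_n -> R) :
    0 <= s ->
    (forall n (X : 'I_M -> 'rV[R[i]]_n) k t, \sum_m H k m * X m 0 t =
      Complex (\sum_j alpha k j * x n X j t) (\sum_j beta k j * x n X j t)) ->
    (forall n (X : 'I_M -> 'rV[R[i]]_n) Q, (forall m, \sum_t csqr (X m 0 t) <= Q) ->
      \sum_j \sum_t x n X j t ^+ 2 <= s * Q) ->
  exists C : R, forall mu CF P L (p : policy K M N mu CF P L) e,
    1 <= P -> K%:R * e <= 2^-1 -> (error_prob p PZ Z H <= e%:E)%E ->
    K%:R * (L%:R * ln 2) <= (TE p)%:R * (#|J|%:R / 2 * ln P + C) + ln 2.
Proof.
move=> s0 xE xs; have [c c0 cP] := signal_converse N alpha beta.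
exists (K%:R * ln c + #|J|%:R * ln 4 + (#|J|%:R + s) * 2).
move=> mu CF P L p e P1 Ke he.
have q1 : 1 <= Num.sqrt P by rewrite -[leLHS]sqrtr1 ler_wsqrtr.
have P0 : 0 < P by rewrite (lt_le_trans _ P1).
have e1 : K%:R * e < 1 by lra.
have [mZ Zind] := Z_iid.
pose Zr (kt : 'I_K * 'I_(TE p)) w := reim (Z (kt.1, val kt.2) w).
have T0 : (0 < #|'I_(2 ^ L)|)%N by rewrite card_ord expn_gt0.
have succE f : success Z p D H f = [set w | forall k,
    decoder k (noisy_row alpha beta (x _ (codeword p f D H)) (Zr ^~ w) k) (D k) H
    = f (D k)].
  have rowE w k : received p f D H (fun t => Z (k, t) w) k =
      noisy_row alpha beta (x _ (codeword p f D H)) (Zr ^~ w) k.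
    apply/rowP => t; rewrite !mxE xE /Zr/=.
    by case: (Z (k, val t) w) => a b.
  by apply/seteqP; split => w h k; have := h k; rewrite rowE.
have := cP 'I_(2 ^ L) (TE p) D (fun f => x _ (codeword p f D H))
  (fun k y => decoder k y (D k) H) _ _ PZ Zr (Num.sqrt P) s (K%:R * e)
  widen_demand_inj T0 q1 e1.
rewrite card_ord natrX lnXn// -[ln 2 *+ L]mulr_natl.
move=> H0; apply: le_trans (H0 _ _ _ _ _) _.
- by move=> i; exact: mZ.
- move=> B mB.
  (* A box over the [TE p] times in use is extended by [setT] to all times, to match the index set
     of [Z_iid]. *)
  pose B' (kt : 'I_K * nat) : set (R * R) :=
    if insub kt.2 is Some t then B (kt.1, t) else setT.
  have mB' kt : measurable (B' kt) by rewrite /B'; case: insubP.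
  pose emb (kt : 'I_K * 'I_(TE p)) : 'I_K * nat := (kt.1, val kt.2).
  have emb_inj : injective emb.
    by move=> [k t] [k' t'] [/= -> /val_inj ->].
  have B'E kt : B' (emb kt) = B kt by rewrite /B'/= valK; case: kt.
  have := Zind [seq emb kt | kt <- index_enum _] B' _ mB'.
  rewrite map_inj_uniq ?index_enum_uniq// big_map => /(_ isT).
  rewrite (eq_bigr (fun kt => @CN01 R (B kt))) => [<-|kt _]; last by rewrite B'E.
  congr (PZ _); apply/seteqP; split => w /= h.
    by move=> _ /mapP[kt _ ->]; rewrite B'E; exact: h.
  move=> i; have := h (emb i); rewrite B'E; apply.
  by apply: map_f; exact: mem_index_enum.
- by move=> k j; exact: (@decoder_measurable _ _ _ _ _ _ _ _ p).
- move=> f; rewrite sqr_sqrtr ?(ltW P0)// [_ * s]mulrC -mulrA; apply: xs => m.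
  exact: (@edge_power _ _ _ _ _ _ _ _ p).
- have := sum_success_ge Z_iid widen_demand_inj he.
  by under eq_bigr do rewrite succE.
have lnq : ln (4 * Num.sqrt P) = ln 4 + ln P / 2.
  rewrite lnM ?posrE ?(lt_le_trans _ q1)//; congr (_ + _).
  rewrite -{2}(sqr_sqrtr (ltW P0)) lnXn ?(lt_le_trans _ q1)//.
  by rewrite -[ln _ *+ 2]mulr_natr mulfK// pnatr_eq0.
apply: lerD; last exact: nln1B_le.
rewrite ler_wpM2l// lnq.
have : (#|J|%:R + s) / (1 - K%:R * e) <= (#|J|%:R + s) * 2.
  rewrite ler_wpM2l ?addr_ge0//.
  by rewrite -[leRHS]invrK lef_pV2 ?posrE ?invr_gt0//; lra.
lra.
Qed.

Lemma edge_bound : exists C : R, forall mu CF P L (p : policy K M N mu CF P L) e,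
    1 <= P -> K%:R * e <= 2^-1 -> (error_prob p PZ Z H <= e%:E)%E ->
    K%:R * (L%:R * ln 2) <=
      (TE p)%:R * ((minn M K)%:R * ln P + C) + ln 2.
Proof.
pose part (z : R[i]) (b : bool) := if b then complex.Im z else complex.Re z.
have csqrE z : part z false ^+ 2 + part z true ^+ 2 = csqr z by [].
have half n : #|{: 'I_n * bool}|%:R / 2 = n%:R :> R.
  by rewrite card_prod card_ord card_bool natrM mulfK// pnatr_eq0.
have [MK|KM] := leqP M K.
  (* For [M <= K] the signals are the real and imaginary parts of the [M] codewords, of total energy
     at most [M%:R * Q]. *)
  pose alpha k (j : 'I_M * bool) :=
    if j.2 then - complex.Im (H k j.1) else complex.Re (H k j.1).
  pose beta k (j : 'I_M * bool) := part (H k j.1) (~~ j.2).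
  pose x n (X : 'I_M -> 'rV[R[i]]_n) (j : 'I_M * bool) t := part (X j.1 0 t) j.2.
  have [||C CP] := @edge_bound_of_signals _ alpha beta M%:R x (ler0n _ _).
  - move=> n X k t; apply/eqP; rewrite eq_complex/= Re_sum Im_sum !sum_pair_bool.
    apply/andP; split; apply/eqP; apply: eq_bigr => m _.
      by rewrite Re_mulc /alpha /x/= mulNr.
    by rewrite Im_mulc /beta /x/= addrC.
  - move=> n X Q XQ; rewrite sum_pair_bool.
    rewrite (eq_bigr (fun m => \sum_t csqr (X m 0 t))); last first.
      by move=> m _; rewrite -big_split.
    apply: le_trans (ler_sum _ (fun m _ => XQ m)) _.
    by rewrite sumr_const card_ord -[leLHS]mulr_natl.
  by exists C => mu CF P L p e P1 Ke he; have := CP _ _ _ _ p e P1 Ke he; rewrite half.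
(* For [K < M] they are the parts of the [K] noiseless received signals; Cauchy-Schwarz bounds their
   energy by [s * Q], with [s] fixed by the channel. *)
pose alpha (k : 'I_K) (j : 'I_K * bool) : R := ((k == j.1) && ~~ j.2)%:R.
pose beta (k : 'I_K) (j : 'I_K * bool) : R := ((k == j.1) && j.2)%:R.
pose y n (X : 'I_M -> 'rV[R[i]]_n) k t := \sum_m H k m * X m 0 t.
pose x n (X : 'I_M -> 'rV[R[i]]_n) (j : 'I_K * bool) t := part (y n X j.1 t) j.2.
pose s := \sum_k M%:R * \sum_m csqr (H k m).
have csqr_ge0 z : 0 <= csqr z :> R by rewrite addr_ge0 ?sqr_ge0.
have s0 : 0 <= s.
  by apply: sumr_ge0 => k _; rewrite mulr_ge0//; apply: sumr_ge0.
have [||C CP] := @edge_bound_of_signals _ alpha beta s x s0.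
- move=> n X k t; rewrite -/(y n X k t); apply/eqP; rewrite eq_complex/= !sum_pair_bool.
  apply/andP; split; apply/eqP; rewrite (bigD1 k)//= big1.
  + by rewrite /alpha /x/= eqxx/= mul1r mul0r !addr0.
  + by move=> i /negbTE ik; rewrite /alpha/= eq_sym ik !mul0r addr0.
  + by rewrite /beta /x/= eqxx/= mul1r mul0r addr0 add0r.
  + by move=> i /negbTE ik; rewrite /beta/= eq_sym ik !mul0r addr0.
- move=> n X Q XQ; rewrite sum_pair_bool.
  rewrite (eq_bigr (fun k => \sum_t csqr (y n X k t))); last first.
    by move=> m _; rewrite -big_split.
  rewrite mulr_suml; apply: ler_sum => k _.
  apply: (@le_trans _ _ (\sum_t M%:R * \sum_m csqr (H k m) * csqr (X m 0 t))).
    by apply: ler_sum => t _; exact: csqr_sumM_le.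
  rewrite -mulr_sumr -mulrA ler_wpM2l// exchange_big/= mulr_suml.
  by apply: ler_sum => m _; rewrite -mulr_sumr ler_wpM2l.
by exists C => mu CF P L p e P1 Ke he; have := CP _ _ _ _ p e P1 Ke he; rewrite half.
Qed.

End edge_bound.

(** * Entropy of a function of a uniform file, and the fronthaul bound *)

Section image_pmf.
Variables (R : realType) (A T : finType) (g : A -> T).
Hypothesis A_gt0 : (0 < #|A|)%N.

Let cA : (#|A|%:R : R) != 0. Proof. by rewrite pnatr_eq0 -lt0n. Qed.

Lemma sum_image_pmf (F : T -> R) :
  \sum_t image_pmf R g t * F t = #|A|%:R^-1 * \sum_a F (g a).
Proof.
rewrite [in RHS](partition_big g predT)//= mulr_sumr; apply: eq_bigr => t _.
rewrite (eq_bigr (fun=> F t)); last by move=> a /eqP ->.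
by rewrite sumr_const -[F t *+ _]mulr_natl mulrA; congr (_ * _); exact: mulrC.
Qed.

Lemma entropy_image_pmf : entropy (image_pmf R g) =
  - (#|A|%:R^-1 * \sum_a log2 (image_pmf R g (g a))).
Proof. by rewrite /entropy sum_image_pmf. Qed.

Lemma sum_image_pmf1 : \sum_t image_pmf R g t = 1.
Proof.
have := sum_image_pmf (fun=> 1); under eq_bigr do rewrite mulr1.
by move=> ->; rewrite sumr_const mulVf.
Qed.

Lemma image_pmf_ge0 t : 0 <= image_pmf R g t.
Proof. by rewrite divr_ge0. Qed.

Lemma image_pmf_gt0 a : 0 < image_pmf R g (g a).
Proof.
rewrite /image_pmf divr_gt0 ?ltr0n//.
by apply/card_gt0P; exists a; rewrite inE eqxx.
Qed.

Lemma image_pmf_le1 t : image_pmf R g t <= 1.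
Proof. by rewrite /image_pmf ler_pdivrMr ?ltr0n// mul1r ler_nat max_card. Qed.

End image_pmf.

(** Encodes [g a] by a canonical element of its fibre, so that cache contents of the varying types
    [cacheT p m n] all live in the single type of files. *)
Definition fiber_rep (A T : finType) (g : A -> T) (a : A) : A :=
  odflt a [pick b | g b == g a].

Lemma fiber_repK (A T : finType) (g : A -> T) (a : A) : g (fiber_rep g a) = g a.
Proof.
by rewrite /fiber_rep; case: pickP => [b /eqP//|/(_ a)]; rewrite eqxx.
Qed.

Lemma fiber_rep_eq (A T : finType) (g : A -> T) (a b : A) :
  (fiber_rep g a == fiber_rep g b) = (g a == g b).
Proof.
apply/eqP/eqP => [ab|ab]; first by rewrite -(fiber_repK g a) ab fiber_repK.
(* Both sides now search the same fibre, which contains [b], so the two different defaults of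
   [odflt] are never reached. *)
rewrite /fiber_rep ab; case: pickP => //= /(_ b); by rewrite eqxx.
Qed.

Lemma image_pmf_fiber_rep (R : realType) (A T : finType) (g : A -> T) (a : A) :
  image_pmf R (fiber_rep g) (fiber_rep g a) = image_pmf R g (g a).
Proof.
rewrite /image_pmf; congr (_%:R / _); apply: eq_card => b.
by rewrite !inE fiber_rep_eq.
Qed.

Lemma front_bound (R : realType) (K M N : nat) (K_le_N : (K <= N)%N)
    (dZ : measure_display) (OmegaZ : measurableType dZ)
    (PZ : probability OmegaZ R) (Z : 'I_K * nat -> OmegaZ -> R[i])
    (Z_iid : iid PZ Z (@CN01 R)) (H : channel R K M) (mu CF P : R) (L : nat)
    (p : policy K M N mu CF P L) (e : R) :
    K%:R * e <= 2^-1 -> (error_prob p PZ Z H <= e%:E)%E ->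
  K%:R * (L%:R * ln 2) <= M%:R * ((TF p)%:R * CF * ln 2) +
    (M%:R * K%:R * (mu * L%:R) * ln 2) / (1 - K%:R * e) + ln 2.
Proof.
move=> Ke he; pose D : demand K N := [ffun k => widen_ord K_le_N k].
have injD : injective D := @widen_demand_inj K N K_le_N.
pose T := 'I_(2 ^ L).
have T0 : (0 < #|T|)%N by rewrite card_ord expn_gt0.
have e1 : K%:R * e < 1 by lra.
have ln2_gt0 : 0 < ln 2 :> R by rewrite ln_gt0// ltr1n.
have ln20 : ln 2 != 0 :> R by rewrite gt_eqF.
pose U := {dffun forall m : 'I_M, frontT p m}.
pose V := ({ffun 'I_M * 'I_K -> T} * U)%type.
pose rep (mk : 'I_M * 'I_K) : T -> T :=
  fiber_rep (@cache _ _ _ _ _ _ _ _ p mk.1 (D mk.2)).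
pose u (f : library N L) : U := [ffun m => front f (cached p f m) D H].
(* Only caches of demanded files are recorded: in [dE] the undemanded files agree, so their caches
   do too. *)
pose v (f : library N L) : V := ([ffun mk => rep mk (f (D mk.2))], u f).
(* A product of marginals even though the caches of one file at several nodes may be dependent: for
   each fronthaul message it sums to 1, so the total weight is [#|U|]. *)
pose w (y : V) : R := \prod_mk image_pmf R (rep mk) (y.1 mk).
have w_ge0 y : 0 <= w y by apply: prodr_ge0 => mk _; exact: image_pmf_ge0.
have w01 f : 0 < w (v f) <= 1.
  rewrite prodr_gt0/=; last by move=> mk _; rewrite ffunE image_pmf_gt0.
  by apply: prodr_ile1 => mk _; rewrite image_pmf_ge0 image_pmf_le1.
have dE f g : v f = v g -> f != g ->
    (forall n, n \notin codom D -> f n = g n) ->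
    success Z p D H f `&` success Z p D H g = set0.
  move=> [/ffunP cfg /ffunP ufg] fg off.
  have cacheE m n : cache p m n (f n) = cache p m n (g n).
    have [/codomP[k ->]|/off ->//] := boolP (n \in codom D).
    by have := cfg (m, k); rewrite [LHS]ffunE [RHS]ffunE => /eqP;
      rewrite fiber_rep_eq => /eqP.
  have cachedE m : cached p f m = cached p g m.
    by apply: functional_extensionality_dep => n; exact: cacheE.
  have cwE m : codeword p f D H m = codeword p g D H m.
    by rewrite /codeword; have := ufg m; rewrite !ffunE => ->; rewrite cachedE.
  apply/seteqP; split => // om [sf sg]; case/negP: fg; apply/eqP/ffunP => n.
  have [/codomP[k ->]|/off//] := boolP (n \in codom D).
  rewrite -(sf k) -(sg k); congr decoder; apply/rowP => t; rewrite !mxE.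
  by under eq_bigr do rewrite cwE.
have mE f := @measurable_success _ _ _ _ _ _ _ _ Z_iid _ _ _ _ p D H f.
have p01 f : 0 <= fine (PZ (success Z p D H f)) <= 1.
  by rewrite fine_ge0//= -lee_fin fineK ?fin_num_measure// probability_le1.
have := decoding_bound injD T0 ler01 e1 mE w_ge0 w01 dE p01 _
  (sum_success_ge Z_iid injD he).
have pE (f : library N L) : fine (PZ (success Z p D H f)) <=
  1 * fine (PZ (success Z p D H f)) by rewrite mul1r.
move=> /(_ _ pE); rewrite ln1 add0r card_ord natrX lnXn// -[ln 2 *+ L]mulr_natl.
move=> /le_trans; apply.
have U0 : (0 < #|U|)%N.
  by apply/card_gt0P; exists (u [ffun=> Ordinal (expn_gt0 2 L)]).
have sumw : \sum_y w y = #|U|%:R.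
  rewrite (eq_bigr (fun y : V => w (y.1, y.2))); last by case.
  rewrite -(pair_bigA _ (fun a b => w (a, b)))/= /w/=.
  under eq_bigr do rewrite sumr_const -mulr_natl.
  rewrite -mulr_sumr -(bigA_distr_bigA (fun mk y => image_pmf R (rep mk) y)).
  by rewrite big1 ?mulr1// => mk _; exact: sum_image_pmf1.
have cU : ln (#|U|%:R : R) <= M%:R * ((TF p)%:R * CF * ln 2).
  have B0 : 0 < 2 `^ ((TF p)%:R * CF) :> R by rewrite powR_gt0.
  rewrite -ln_powR mulr_natl -lnXn// ler_ln ?posrE ?ltr0n ?exprn_gt0//.
  rewrite card_dep_ffun foldrE big_map big_enum/= natr_prod.
  apply: (@le_trans _ _ (\prod_(m in 'I_M) 2 `^ ((TF p)%:R * CF))).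
    by apply: ler_prod => m _; rewrite ler0n/= front_size.
  by rewrite prodr_const card_ord.
have avg : - (#|{: library N L}|%:R^-1 * \sum_f ln (w (v f))) <=
    M%:R * K%:R * (mu * L%:R) * ln 2.
  have -> : \sum_f ln (w (v f)) = \sum_mk \sum_(f : library N L)
      ln (image_pmf R (@cache _ _ _ _ _ _ _ _ p mk.1 (D mk.2))
        (cache p mk.1 (D mk.2) (f (D mk.2)))).
    rewrite exchange_big/=; apply: eq_bigr => f _.
    rewrite ln_prod => [|mk]; last by rewrite ffunE image_pmf_gt0.
    by apply: eq_bigr => mk _; rewrite ffunE image_pmf_fiber_rep.
  rewrite mulr_sumr -sumrN.
  apply: (@le_trans _ _ (\sum_(mk : 'I_M * 'I_K) mu * L%:R * ln 2)); last first.
    by rewrite sumr_const card_prod !card_ord -[leLHS]mulr_natl natrM !mulrA.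
  apply: ler_sum => -[m k] _ /=.
  (* Each term involves the single file [D k], so its average over libraries is minus an entropy, up
     to the factor [ln 2]. *)
  pose phi (x : T) : R :=
    ln (image_pmf R (@cache _ _ _ _ _ _ _ _ p m (D k)) (cache p m (D k) x)).
  have cT : (#|T|%:R : R) != 0 by rewrite pnatr_eq0 -lt0n.
  have -> : #|{: library N L}|%:R^-1 * \sum_(f : library N L) phi (f (D k)) =
      #|T|%:R^-1 * \sum_x phi x.
    have := sum_ffun_coord phi (D k); rewrite card_ffun (card_ord N) natrX => S.
    by apply: (mulfI cT); rewrite mulrCA S mulKf ?expf_neq0// mulVKf.
  have := @cache_size _ _ _ _ _ _ _ _ p m (D k).
  rewrite entropy_image_pmf.
  move=> /(ler_wpM2r (ltW ln2_gt0)) h; apply: le_trans h.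
  rewrite mulNr lerN2 -mulrA mulr_suml le_eqVlt; apply/orP; left; apply/eqP.
  by congr (_ * _); apply: eq_bigr => x _; rewrite /log2 divfK.
have e1' : 0 < 1 - K%:R * e by rewrite subr_gt0.
have : - (#|{: library N L}|%:R^-1 * \sum_f ln (w (v f))) / (1 - K%:R * e) <=
    M%:R * K%:R * (mu * L%:R) * ln 2 / (1 - K%:R * e).
  by rewrite ler_pM2r ?invr_gt0.
have := nln1B_le Ke; rewrite sumw mulNr; lra.
Qed.

(** * Asymptotics *)

Lemma le_of_affine_le (R : realFieldType) (a b k : R) : 0 <= k ->
  (forall eta, 0 < eta <= 1 -> a - eta * k <= b) -> a <= b.
Proof.
move=> k0 H; rewrite leNgt; apply/negP => ba.
have ab0 : 0 < a - b by rewrite subr_gt0.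
have k1 : 0 < k + 1 by rewrite ltr_wpDl.
pose eta := Num.min 1 ((a - b) / (2 * (k + 1))).
have eta0 : 0 < eta by rewrite lt_min ltr01 divr_gt0// mulr_gt0.
have := H eta; rewrite eta0 ge_min lexx/= => /(_ isT).
have : eta * (2 * (k + 1)) <= a - b.
  by rewrite -ler_pdivlMr ?mulr_gt0// ge_min lexx orbT.
have : 0 <= eta * k by rewrite mulr_ge0// ltW.
lra.
Qed.

Lemma limn_esup_ge (R : realType) (u : nat -> \bar R) (a : \bar R) :
  (\forall n \near \oo, (a <= u n)%E) -> (a <= limn_esup u)%E.
Proof.
move=> au; apply: le_ereal_inf_tmp => _ [V Voo <-].
have [n [Vn an]] := @filter_ex _ \oo _ _ (filterI Voo au).
by apply: le_trans an _; apply: ereal_sup_ubound; exists n.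
Qed.

Section converse.
Variables (R : realType) (K M N : nat).
Hypotheses (K_gt0 : (0 < K)%N) (M_gt0 : (0 < M)%N) (K_le_N : (K <= N)%N).
Variables (dZ : measure_display) (OmegaZ : measurableType dZ)
  (PZ : probability OmegaZ R) (Z : 'I_K * nat -> OmegaZ -> R[i]).
Hypothesis Z_iid : iid PZ Z (@CN01 R).

Let n : R := (minn M K)%:R.

(* [theta] selects whether the fronthaul contribution is counted, which is only
   possible for [r > 0]. *)
Lemma time_lower_bound (H : channel R K M) : exists C : R,
  forall (theta : bool) (mu r P Delta : R)
    (p : forall L, policy K M N mu (r * log2 P) P L),
    (theta -> 0 < r) -> 0 <= mu -> 0 <= r -> 1 < P -> 0 < n * ln P + C ->
    (error_prob (p L) PZ Z H @[L --> \oo] --> 0%E) ->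
    limn_esup (fun L => (((TF (p L) + TE (p L))%:R : R) / L%:R)%:E) = Delta%:E ->
  K%:R * ln 2 / (n * ln P + C) +
    theta%:R * (K%:R * (1 - M%:R * mu) * ln 2 / (M%:R * r * ln P)) <= Delta.
Proof.
have [C CP] := edge_bound K_le_N Z_iid H; exists C.
move=> theta mu r P Delta p theta_r mu0 r0 P1 A0 pe esup.
have K0 : 0 < K%:R :> R by rewrite ltr0n.
have M0 : 0 < M%:R :> R by rewrite ltr0n.
have ln2 : 0 < ln 2 :> R by rewrite ln_gt0// ltr1n.
have lnP : 0 < ln P by rewrite ln_gt0.
set A := n * ln P + C in A0 *.
pose B := M%:R * r * ln P.
have B0 : 0 <= B by rewrite !mulr_ge0// ltW.
(* The multiplier of [eta] collects the losses: [ln 2 / A] from the edge, the rest from the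
   fronthaul. *)
apply: (@le_of_affine_le _ _ _ (ln 2 / A +
  theta%:R * ((M%:R * K%:R * mu + 1) * ln 2 / B))).
  apply: addr_ge0; first by rewrite divr_ge0// ltW.
  apply: mulr_ge0 => //; apply: divr_ge0 => //; apply: mulr_ge0; last exact: ltW.
  by rewrite addr_ge0 ?mulr_ge0.
move=> eta /andP[eta0 eta1].
rewrite -lee_fin -esup; apply: limn_esup_ge.
(* At this error level [K%:R * e = eta / 2], within the bound 1/2 that both converse bounds
   assume. *)
have eK0 : 0 < eta / (2 * K%:R) by rewrite divr_gt0// mulr_gt0.
have Ke : K%:R * (eta / (2 * K%:R)) = eta / 2 by field; rewrite gt_eqF.
near=> L.
have he : (error_prob (p L) PZ Z H <= (eta / (2 * K%:R))%:E)%E.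
  apply: ltW; near: L; apply: (pe [set x | (x < (eta / (2 * K%:R))%:E)%E]).
  by apply: open_ereal_lt'; rewrite lte_fin.
(* Once [L%:R] exceeds [eta^-1], the additive constant [ln 2] is at most [eta * L%:R * ln 2]. *)
have L1 : eta^-1 <= L%:R by near: L; exact: nbhs_infty_ger.
have L0 : 0 < L%:R :> R by rewrite (lt_le_trans _ L1)// invr_gt0.
have etaL : 1 <= eta * L%:R by rewrite mulrC -ler_pdivrMr// mul1r.
have Ke2 : K%:R * (eta / (2 * K%:R)) <= 2^-1 by rewrite Ke; lra.
have hE := CP _ _ _ _ (p L) _ (ltW P1) Ke2 he.
have hF := front_bound K_le_N Z_iid Ke2 he.
have ln2L : ln 2 <= eta * L%:R * ln 2 :> R by rewrite ler_peMl// ltW.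
have hE' : (K%:R - eta) * ln 2 / A <= (TE (p L))%:R / L%:R.
  rewrite ler_pdivrMr// [leRHS]mulrAC ler_pdivlMr//.
  by move: hE; rewrite -/n -/A; lra.
have hF' : theta%:R * ((K%:R * (1 - M%:R * mu) - eta * (M%:R * K%:R * mu + 1)) * ln 2 / B)
    <= (TF (p L))%:R / L%:R.
  case: theta theta_r => [/(_ isT) r_gt0|_]; last by rewrite mul0r divr_ge0.
  have B1 : 0 < B by rewrite !mulr_gt0.
  rewrite mul1r ler_pdivrMr// [leRHS]mulrAC ler_pdivlMr//.
  move: hF; rewrite Ke.
  have -> : M%:R * ((TF (p L))%:R * (r * log2 P) * ln 2) = (TF (p L))%:R * B.
    by rewrite /log2 /B; field; rewrite gt_eqF.
  have : M%:R * K%:R * (mu * L%:R) * ln 2 / (1 - eta / 2) <=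
      M%:R * K%:R * (mu * L%:R) * ln 2 * (1 + eta).
    rewrite ler_wpM2l ?mulr_ge0// ?(ltW ln2)//.
    have e2 : 0 < 1 - eta / 2 by lra.
    rewrite -[leLHS]mul1r ler_pdivrMr//.
    have : 0 <= eta * (1 - eta) by rewrite mulr_ge0 ?subr_ge0// ltW.
    lra.
  lra.
rewrite lee_fin -/B natrD [leRHS]mulrDl.
apply: le_trans _ (lerD hF' hE').
rewrite le_eqVlt; apply/orP; left; apply/eqP; ring.
Unshelve. all: by end_near. Qed.

(** The constant of [time_lower_bound] depends on the channel, and the exceptional null set on [P].
    Integer powers involve only countably many null sets, so one realization [w], with a single [C],
    serves them all. *)
Lemma ndt_lower_bound (dH : measure_display) (OmegaH : measurableType dH)
    (PH : probability OmegaH R) (H : OmegaH -> channel R K M)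
    (theta : bool) (mu r delta : R) :
    (theta -> 0 < r) -> 0 <= mu -> 0 <= r ->
    achievable_ndt N PH H PZ Z mu r delta ->
  K%:R / n + theta%:R * (K%:R * (1 - M%:R * mu) / (M%:R * r)) <= delta.
Proof.
move=> theta_r mu0 r0 [Delta [[P0 [_ DeltaP]] Delta_cvg]].
have K0 : 0 < K%:R :> R by rewrite ltr0n.
have M0 : 0 < M%:R :> R by rewrite ltr0n.
have n0 : 0 < n by rewrite ltr0n leq_min M_gt0.
have ln2 : 0 < ln 2 :> R by rewrite ln_gt0// ltr1n.
pose good (k : nat) w := P0 < k%:R ->
  exists p : forall L, policy K M N mu (r * log2 k%:R) k%:R L,
    (error_prob (p L) PZ Z (H w) @[L --> \oo] --> 0%E) /\
    limn_esup (fun L => (((TF (p L) + TE (p L))%:R : R) / L%:R)%:E) = (Delta k%:R)%:E.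
have good_ae k : {ae PH, forall w, good k w}.
  have [kP|kP] := ltP P0 k%:R; last first.
    by apply: aeW => w; rewrite /good ltNge kP.
  have [p [feas esup]] := DeltaP _ kP.
  by apply: filterS feas => w pw _; exists p.
have PH0 : (0 < PH setT)%E by rewrite probability_setT lte01.
have PF := ae_properfilter_algebraOfSetsType PH0.
have [w gw] := @filter_ex _ _ PF _ (ae_foralln good_ae).
have [C CP] := time_lower_bound (H w).
apply: (@le_of_affine_le _ _ _ 1) => // eta /andP[eta0 _]; rewrite mulr1.
(* Chosen so that [X <= ln k%:R] makes [A = n * ln k%:R + C] positive and large enough for the
   correction [K%:R * C / (n * A)] to be at most [eta]. *)
pose X := (`|C| + 1 + K%:R * `|C| / (n * eta)) / n.
have ndt_cvg := cvg_comp (fun k : nat => k%:R : R) (fun P => Delta P * log2 P)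
  (@cvgr_idn R) Delta_cvg.
apply: (cvgr_to_ge ndt_cvg).
near=> k.
have kP : P0 < k%:R by near: k; exact: nbhs_infty_gtr.
have k1 : 1 < k%:R :> R by near: k; exact: nbhs_infty_gtr.
have kX : expR X <= k%:R by near: k; exact: nbhs_infty_ger.
have lnk : 0 < ln k%:R :> R by rewrite ln_gt0.
have {}kX : X <= ln k%:R.
  by rewrite -[leLHS]expRK ler_ln ?posrE ?expR_gt0// (lt_trans _ k1).
have KC : 0 <= K%:R * `|C| / (n * eta) by rewrite divr_ge0 ?mulr_ge0// ltW.
have Cn : - C <= `|C| by rewrite -normrN ler_norm.
have A1 : 1 + K%:R * `|C| / (n * eta) <= n * ln k%:R + C.
  by move: kX; rewrite /X ler_pdivrMr// mulrC; lra.
have A0 : 0 < n * ln k%:R + C by lra.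
have [p [pe esup]] := gw k kP.
have := CP theta mu r k%:R (Delta k%:R) p theta_r mu0 r0 k1 A0 pe esup.
rewrite -(ler_pM2r (_ : 0 < log2 k%:R)) ?divr_gt0//; apply: le_trans.
set A := n * ln k%:R + C in A0 A1 *.
have -> : (K%:R * ln 2 / A + theta%:R *
    (K%:R * (1 - M%:R * mu) * ln 2 / (M%:R * r * ln k%:R))) * log2 k%:R =
    K%:R * ln k%:R / A + theta%:R * (K%:R * (1 - M%:R * mu) / (M%:R * r)).
  case: theta theta_r => [/(_ isT) r_gt0|_]; rewrite /log2.
    by field; rewrite ?(gt_eqF A0) ?(gt_eqF ln2) ?(gt_eqF lnk) ?(gt_eqF M0)
      ?(gt_eqF r_gt0).
  by rewrite !mul0r !addr0; field; rewrite ?(gt_eqF A0) ?(gt_eqF ln2).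
rewrite addrAC lerD2r.
have -> : K%:R * ln k%:R / A = K%:R / n - K%:R * C / (n * A).
  by rewrite /A; field; rewrite !gt_eqF.
rewrite lerD2l lerN2 ler_pdivrMr ?mulr_gt0//.
apply: (@le_trans _ _ (K%:R * `|C|)); first by rewrite ler_wpM2l// ?ler_norm// ltW.
rewrite mulrCA mulrA -ler_pdivrMl ?mulr_gt0// mulrC.
lra.
Unshelve. all: by end_near. Qed.

End converse.

(** * Comparison of the achievable NDT with the converse bounds *)

Lemma ndt_ach_le (R : realType) (K M : nat) (mu r delta : R) :
    (0 < K)%N -> (0 < M)%N ->
    (r = 0 /\ M%:R^-1 <= mu <= 1) \/ (0 < r /\ 0 <= mu <= 1) ->
    K%:R / (minn M K)%:R <= delta ->
    (0 < r -> K%:R / (minn M K)%:R + K%:R * (1 - M%:R * mu) / (M%:R * r) <= delta) ->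
  ndt_ach K M mu r <= 2 * delta.
Proof.
move=> K_gt0 M_gt0 mu_r b1 b2.
have K0 : 0 < K%:R :> R by rewrite ltr0n.
have M0 : 0 < M%:R :> R by rewrite ltr0n.
have n_gt0 : (0 < minn M K)%N by rewrite leq_min M_gt0.
rewrite /ndt_ach; set k := K%:R in K0 b1 b2 *; set m := M%:R in M0 mu_r b1 b2 *.
set n := (minn M K)%:R in b1 b2 *.
have n0 : 0 < n by rewrite ltr0n.
have n1 : 1 <= n by rewrite ler1n.
have nk : n <= k by rewrite ler_nat geq_minr.
have kn1 : 1 <= k / n by rewrite ler_pdivlMr// mul1r.
(* Source of the factor 2: [m + k - 1] is less than twice the larger of [m] and [k], and that larger
   one is [m * (k / n)]. *)
have key : (m + k - 1) / m <= 2 * (k / n).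
  rewrite ler_pdivrMr//.
  have [MK|KM] := leqP M K.
    have nm : n = m by rewrite /n (minn_idPl MK).
    by rewrite nm -mulrA divfK ?gt_eqF//; rewrite -nm; lra.
  have nk' : n = k by rewrite /n (minn_idPr (ltnW KM)).
  have : k <= m by rewrite ler_nat ltnW.
  by rewrite nk' divff ?gt_eqF//; lra.
have mu1 : mu <= 1 by case: mu_r => [[_ /andP[]]|[_ /andP[]]].
have mu0 : 0 <= mu.
  by case: mu_r => [[_ /andP[h _]]|[_ /andP[]]]//; apply: le_trans h; rewrite invr_ge0 ltW.
case: ifPn => [_|]; [case: ifPn => [mum|]|].
- have t1 : mu * m <= 1 by rewrite -ler_pdivlMr// mul1r.
  have : mu * m * ((m + k - 1) / m) <= mu * m * (2 * (k / n)).
    by rewrite ler_wpM2l// mulr_ge0// ltW.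
  have -> : mu * m * ((m + k - 1) / m) = (m + k - 1) * mu by field; rewrite gt_eqF.
  (* When [r = 0], the constraints force [mu = m^-1], and the factor [1 - mu * m] cancels the term
     divided by [r]. *)
  case: mu_r => [[-> /andP[mum' _]]|[r0 _]].
    have -> : mu = m^-1 by apply/eqP; rewrite eq_le mum.
    rewrite mulVf ?gt_eqF//; lra.
  have := b2 r0.
  have -> : k * (1 - m * mu) / (m * r) = (1 - mu * m) * (k / (m * r)).
    by field; rewrite !gt_eqF.
  have y0 : 0 <= (1 - mu * m) * (k / (m * r)).
    by rewrite mulr_ge0 ?subr_ge0// divr_ge0 ?mulr_ge0// ltW.
  have : 0 <= (1 - mu * m) * (k / n) by rewrite mulr_ge0 ?subr_ge0// divr_ge0// ltW.
  lra.
- rewrite -ltNge => mum.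
  have m1 : 0 < m - 1.
    by rewrite subr_gt0 -(invf_lt1 M0); exact: lt_le_trans mum mu1.
  have t1 : 1 <= mu * m by rewrite -ler_pdivrMr// mul1r ltW.
  (* This branch is affine in [mu]; [lam] goes from 0 at [mu = m^-1] to 1 at [mu = 1] and
     interpolates between [(m + k - 1) / m] and [k / n]. *)
  set lam := (mu * m - 1) / (m - 1).
  have lam0 : 0 <= lam by rewrite divr_ge0 ?(ltW m1)// subr_ge0.
  have lam1 : 0 <= 1 - lam.
    by rewrite subr_ge0 ler_pdivrMr// mul1r lerD2r ler_piMl// ltW.
  have -> : (1 - mu) * ((m + k - 1) / (m - 1)) = (1 - lam) * ((m + k - 1) / m).
    by rewrite /lam; field; rewrite !gt_eqF.
  have : (1 - lam) * ((m + k - 1) / m) <= (1 - lam) * (2 * (k / n)) by rewrite ler_wpM2l.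
  have : 0 <= k / n * lam by rewrite mulr_ge0// divr_ge0// ltW.
  lra.
rewrite -ltNge /r_th -/k -/m -/n => rth.
(* For [M = 1] the threshold evaluates to 0, so [r] is positive and the second converse bound
   coincides with this branch. *)
have [M1|M1] := leqP M 1.
  have m1 : m = 1 by rewrite /m (_ : M = 1%N)//; apply/eqP; rewrite eqn_leq M1.
  move: rth; rewrite m1 subrr mulr0 mul0e lte_fin => r0.
  have := b2 r0; rewrite m1 !mul1r.
  rewrite [k * (1 - mu)]mulrC.
  have : 0 <= (1 - mu) * k / r by rewrite divr_ge0 ?mulr_ge0 ?subr_ge0// ltW.
  lra.
have m1 : 0 < m - 1 by rewrite subr_gt0 ltr1n.
(* Here [M] exceeds 1, so a minimum of 1 makes the threshold infinite and contradicts [rth]. *)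
have [n1'|n1'] := leqP (minn M K) 1.
  have nE : n = 1 by rewrite /n (_ : minn M K = 1%N)//; apply/eqP; rewrite eqn_leq n1'.
  move: rth; rewrite nE subrr mulr0 inve0 gt0_muley ?lte_fin ?mulr_gt0//.
have nn1 : 0 < n - 1 by rewrite subr_gt0 ltr1n.
have mn0 : m * (n - 1) != 0 by rewrite gt_eqF// mulr_gt0.
move: rth; rewrite inver (negbTE mn0) -EFinM lte_fin => rth.
have r0 : 0 < r by apply: lt_trans rth; rewrite divr_gt0 ?mulr_gt0.
have nm : n <= m by rewrite ler_nat geq_minl.
(* Above the threshold, [n <= m] gives [k <= m * r], so the fronthaul term is at most 1 and hence at
   most [k / n]. *)
have : (1 - mu) * k / (m * r) <= 1.
  rewrite ler_pdivrMr ?mulr_gt0// mul1r.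
  apply: (@le_trans _ _ k); first by rewrite ler_piMl ?(ltW K0)// gerBl.
  move: rth; rewrite ltr_pdivrMr ?mulr_gt0// => rth.
  have : k * (m - 1) <= m * r * (m - 1).
    apply: (le_trans (ltW rth)); rewrite mulrA [r * m]mulrC.
    by rewrite ler_wpM2l ?lerD2r// mulr_ge0 ?(ltW M0)// ltW.
  by rewrite ler_pM2r.
lra.
Qed.

Theorem proposition8 (R : realType) (K M N : nat)
  (K_gt0 : (0 < K)%N) (M_gt0 : (0 < M)%N) (K_le_N : (K <= N)%N)
  (lawH : probability (R * R)%type R) (lawH_cont : continuous_law lawH)
  (dH : measure_display) (OmegaH : measurableType dH)
  (PH : probability OmegaH R) (H : OmegaH -> 'M[R[i]]_(K, M))
  (H_iid : iid PH (fun (km : 'I_K * 'I_M) w => H w km.1 km.2) lawH)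
  (dZ : measure_display) (OmegaZ : measurableType dZ)
  (PZ : probability OmegaZ R) (Z : 'I_K * nat -> OmegaZ -> R[i])
  (Z_iid : iid PZ Z (@CN01 R))
  (mu r : R)
  (mu_r : (r = 0 /\ M%:R^-1 <= mu <= 1) \/ (0 < r /\ 0 <= mu <= 1)) :
  ((ndt_ach K M mu r)%:E / min_ndt N PH H PZ Z mu r <= 2%:E)%E.
Proof.
have r0 : 0 <= r by case: mu_r => [[->]|[/ltW]].
have mu0 : 0 <= mu.
  by case: mu_r => [[_ /andP[h _]]|[_ /andP[]]]//; apply: le_trans h; rewrite invr_ge0.
have n0 : 0 < (minn M K)%:R :> R by rewrite ltr0n leq_min M_gt0.
have K0 : 0 < K%:R :> R by rewrite ltr0n.
pose kn : R := K%:R / (minn M K)%:R.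
have kn0 : 0 < kn by rewrite divr_gt0.
have lower (theta : bool) := @ndt_lower_bound R K M N K_gt0 M_gt0 K_le_N _ _ PZ Z
  Z_iid _ _ PH H theta mu r.
have edge delta : achievable_ndt N PH H PZ Z mu r delta -> kn <= delta.
  move=> h; have notr : false -> 0 < r by [].
  by have := lower false delta notr mu0 r0 h; rewrite mul0r addr0.
set I := min_ndt _ _ _ _ _ _ _.
have I_ge_kn : (kn%:E <= I)%E.
  by apply: le_ereal_inf_tmp => _ [delta hdelta <-]; rewrite lee_fin edge.
have I_ge_ach : ((ndt_ach K M mu r / 2)%:E <= I)%E.
  apply: le_ereal_inf_tmp => _ [delta hdelta <-]; rewrite lee_fin.
  rewrite ler_pdivrMr// mulrC; apply: ndt_ach_le => // [|r_gt0]; first exact: edge.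
  by have := lower true delta (fun=> r_gt0) mu0 r0 hdelta; rewrite mul1r.
(* A finite infimum is positive, which permits the division; it is [+oo] when no NDT is achievable,
   and the ratio is then 0; [-oo] contradicts the lower bounds. *)
move: I I_ge_kn I_ge_ach => [x| |]; last by rewrite leeNy_eq.
- rewrite !lee_fin => knx achx; have x0 : 0 < x := lt_le_trans kn0 knx.
  rewrite inver gt_eqF// -EFinM lee_fin ler_pdivrMr//.
  by move: achx; rewrite ler_pdivrMr// mulrC.
- by move=> _ _; rewrite invey mule0 lee_fin.
Qed.
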